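(* For every $j\ge1$, $$0\le\rho_j^2(m)\uparrow\rho_j^2\le1\qquad\text{as }m\to\infty,$$ where $\rho_j^2(m)$ and $\rho_j^2$ are the $j$-th eigenvalues of $T(m)T^*(m)$ and $TT^*$.
   Context: Setting. $E\subseteq\mathbb R$, $\nu$ is a $\sigma$-finite measure on $E$, $\mathcal H=L^2(E,\nu)$, $X$ is a mean-zero random element of $\mathcal H$ with $\mathrm E\|X\|^4_{\mathcal H}<\infty$ and covariance operator $S=\mathrm E[X\otimes X]$, where $(f\otimes g)h=\langle f,h\rangle g$. $\mathcal H=\mathcal H_1\oplus\mathcal H_2$ with $\mathcal H_1\perp\mathcal H_2$ closed subspaces and orthogonal projections $\Upsilon_1,\Upsilon_2$; $X_i=\Upsilon_iX$, $S_i=\Upsilon_iS\Upsilon_i$ (on $\mathcal H_i$, injective), $S_{12}=\Upsilon_1S\Upsilon_2:\mathcal H_2\to\mathcal H_1$. $\{\phi_{ij}\}_j$ is an orthonormal basis of $\mathcal H_i$ of eigenvectors of $S_i$ with eigenvalues $\lambda_{i1}\ge\lambda_{i2}\ge\cdots>0$, and $P_{ih}$ is the eigenprojection of $S_i$ for its $h$-th largest distinct eigenvalue. Let $\gamma_{jk}=\mathrm E[\langle X_1,\phi_{1j}\rangle\langle X_2,\phi_{2k}\rangle]$. $A^\dagger$ is the Moore–Penrose inverse. RKHS. $\mathcal H(K_i)$ is the reproducing kernel Hilbert space of the covariance kernel $K_i$ of $X_i$: as a set it is $\operatorname{Im}(S_i^{1/2})$, with $\|f\|^2_{\mathcal H(K_i)}=\sum_j\langle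 f,\phi_{ij}\rangle^2/\lambda_{ij}$. $\Gamma_i:\mathcal H_i\to\mathcal H(K_i)$, $\Gamma_ig=\sum_j\sqrt{\lambda_{ij}}\langle g,\phi_{ij}\rangle\phi_{ij}$, is unitary. Operators. $T:\mathcal H(K_2)\to\mathcal H(K_1)$ is $(T\tilde g)(s)=\langle K_{12}(s,\cdot),\tilde g\rangle_{\mathcal H(K_2)}$ with $K_{12}(s,t)=\mathrm E[X_1(s)X_2(t)]$; equivalently $T=\Gamma_1C\Gamma_2^{-1}$, where $C:\mathcal H_2\to\mathcal H_1$ is the bounded operator with $\langle C\phi_{2k},\phi_{1j}\rangle=\gamma_{jk}/\sqrt{\lambda_{1j}\lambda_{2k}}$. $T$ is assumed to admit a singular value decomposition $T=\sum_k\rho_k\,\tilde g_k\otimes_{\mathcal H(K_2)}\tilde f_k$ (so $T$ is compact). For $m\ge1$, $\Pi_i(m)=\sum_{h=1}^mP_{ih}$, $S_i(m)=S_i\Pi_i(m)$, and $T(m)=\Gamma_1\,(S_1(m)^{1/2})^{\dagger}\,S_{12}\,(S_2(m)^{1/2})^{\dagger}\,\Gamma_2^{-1}$. Eigenvalues are listed in decreasing order, repeated according to multiplicity (with $\rho_j^2(m)=0$ for $j$ larger than the rank). *)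

(* Defs.v *)
From HB Require Import structures.
From mathcomp Require Import all_boot all_order all_algebra ring_quotient.
From mathcomp Require Import all_classical all_reals all_analysis measurable_realfun.
Set Implicit Arguments.
Unset Strict Implicit.
Unset Printing Implicit Defensive.
Import Order.TTheory GRing.Theory Num.Theory.
Import numFieldNormedType.Exports.
Local Open Scope classical_set_scope.
Local Open Scope ring_scope.

(* A subset E of R with the trace of the Borel sigma-algebra.  The point t0 is
   there because a measurableType is pointed; it only says that E is nonempty. *)
Section trace.
Context {R : realType} {E : set R} (t0 : E).

Definition pointedTrace : Type := E.
HB.instance Definition _ := Choice.on pointedTrace.
HB.instance Definition _ := isPointed.Build pointedTrace t0.

Definition traceBorel :=
  g_sigma_algebra_preimageType (fun t : pointedTrace => val t : R).
HB.instance Definition _ := Measurable.on traceBorel.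

End trace.

(* The library has square-integrable functions as a module (LfunType) and
   classes modulo a.e. equality as a bare type (LspaceType); [L2 mu] is the
   quotient of the former by the null functions, which is again a module. *)
Section L2.
Context {d} {T : measurableType d} {R : realType}.
Variable mu : {measure set T -> \bar R}.
Local Notation Lfun2 := (LfunType mu (lee1n 2)).

Definition aeNull : {pred Lfun2} :=
  [pred f : Lfun2 | `[< \forall x \ae mu, f x = 0 >]].

Lemma aeNull_zmod_closed : zmod_closed aeNull.
Proof.
split=> [|f g]; first by apply/asboolP; apply: aeW.
move=> /asboolP f0 /asboolP g0; apply/asboolP.
by apply: filterS2 f0 g0 => x fx gx; rewrite [LHS](_ : _ = f x - g x)// fx gx subrr.
Qed.
HB.instance Definition _ := GRing.isZmodClosed.Build Lfun2 aeNull
  aeNull_zmod_closed.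

Lemma aeNull_scale (a : R) (f : Lfun2) : f \in aeNull -> a *: f \in aeNull.
Proof.
move=> /asboolP f0; apply/asboolP.
by apply: filterS f0 => x fx; rewrite [LHS](_ : _ = a * f x)// fx mulr0.
Qed.

Definition L2 : Type := Quotient.quot aeNull.
HB.instance Definition _ := GRing.Zmodule.on L2.

Definition L2class (f : Lfun2) : L2 := \pi_(Quotient.quot aeNull)%qT f.
Definition L2repr (f : L2) : Lfun2 := repr (f : Quotient.quot aeNull).

Lemma L2reprK f : L2class (L2repr f) = f. Proof. exact: reprK. Qed.

Lemma L2classD f g : L2class (f + g) = L2class f + L2class g.
Proof. exact: Quotient.pi_add. Qed.

Lemma L2classP f g : L2class f = L2class g <-> f - g \in aeNull.
Proof.
by rewrite Quotient.idealrBE; split=> [fg|/eqP//]; apply/eqP.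
Qed.

Definition L2scale (a : R) (f : L2) : L2 := L2class (a *: L2repr f).

Lemma L2class_scale a f : L2scale a (L2class f) = L2class (a *: f).
Proof.
by apply/L2classP; rewrite -scalerBr aeNull_scale//; apply/L2classP/L2reprK.
Qed.

Lemma L2scaleA a b f : L2scale a (L2scale b f) = L2scale (a * b) f.
Proof. by rewrite -[f]L2reprK !L2class_scale scalerA. Qed.

Lemma L2scale1 : left_id 1 L2scale.
Proof. by move=> f; rewrite -[f]L2reprK !L2class_scale scale1r. Qed.

Lemma L2scaleDr : right_distributive L2scale +%R.
Proof.
by move=> a f g; rewrite -[f]L2reprK -[g]L2reprK -L2classD !L2class_scale
  -L2classD scalerDr.
Qed.

Lemma L2scaleDl f : {morph L2scale^~ f : a b / a + b}.
Proof.
by move=> a b; rewrite -[f]L2reprK !L2class_scale scalerDl L2classD.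
Qed.

HB.instance Definition _ :=
  GRing.Zmodule_isLmodule.Build R L2 L2scaleA L2scale1 L2scaleDr L2scaleDl.

Definition L2dot (f g : L2) : R := (\int[mu]_x (L2repr f x * L2repr g x))%R.

Lemma L2repr_class (f : Lfun2) : \forall x \ae mu, L2repr (L2class f) x = f x.
Proof.
have /L2classP/asboolP : L2class (L2repr (L2class f)) = L2class f.
  by rewrite L2reprK.
apply: filterS => x; rewrite [LHS](_ : _ = L2repr (L2class f) x - f x)//.
by move/eqP; rewrite subr_eq0 => /eqP.
Qed.

Lemma L2dotE (f g : Lfun2) :
  L2dot (L2class f) (L2class g) = (\int[mu]_x (f x * g x))%R.
Proof.
congr fine; apply: ae_eq_integral => //.
- by apply/measurable_EFinP; apply: measurable_funM.
- by apply/measurable_EFinP; apply: measurable_funM.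
- by apply: filterS2 (L2repr_class f) (L2repr_class g) => x -> -> _.
Qed.

End L2.

(* An inner product space given by a set of vectors of V and an inner product
   on it: the reproducing kernel Hilbert spaces below consist of elements of
   L2 but carry another inner product.  Operators between two such spaces are
   functions V -> V, of which only the values on the carrier are relevant. *)
Record ipSpace (R : realType) (V : lmodType R) :=
  IPSpace { carrier : set V ; dot : V -> V -> R }.

Definition L2space {d} {T : measurableType d} {R : realType}
    (mu : {measure set T -> \bar R}) : ipSpace (L2 mu) :=
  IPSpace setT (@L2dot _ _ _ mu).

Section hilbert.
Context {R : realType} {V : lmodType R}.
Implicit Types (A B : ipSpace V) (D : set V) (T : V -> V) (J : set nat)
  (e phi : nat -> V) (lam l rho : nat -> R).

Definition ip_restrict A D : ipSpace V := IPSpace D (dot A).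

Definition ipnorm A (x : V) : R := Num.sqrt (dot A x x).

Definition tends A (u : nat -> V) (x : V) : Prop :=
  ipnorm A (u n - x) @[n --> \oo] --> 0.

Definition ipopen A (U : set V) : Prop := U `<=` carrier A /\
  forall x, U x -> exists2 eps, 0 < eps &
    forall y, carrier A y -> ipnorm A (y - x) < eps -> U y.

Definition closed_subspace A D : Prop :=
  [/\ D `<=` carrier A, D 0,
      forall a x y, D x -> D y -> D (a *: x + y) &
      forall u x, (forall n, D (u n)) -> carrier A x -> tends A u x -> D x].

Definition bounded_operator A B T : Prop :=
  [/\ forall x, carrier A x -> carrier B (T x),
      forall a x y, carrier A x -> carrier A y ->
        T (a *: x + y) = a *: T x + T y &
      exists M, forall x, carrier A x -> ipnorm B (T x) <= M * ipnorm A x].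

Definition is_adjoint A B T (T' : V -> V) : Prop :=
  (forall y, carrier B y -> carrier A (T' y)) /\
  forall x y, carrier A x -> carrier B y -> dot B (T x) y = dot A x (T' y).

Definition positive_operator A T : Prop :=
  [/\ bounded_operator A A T, is_adjoint A A T T &
      forall x, carrier A x -> 0 <= dot A (T x) x].

Definition op_sqrt A T : V -> V := xget (cst 0)
  [set B | positive_operator A B /\ forall x, carrier A x -> B (B x) = T x].

(* The Penrose equations.  An everywhere defined bounded G exists exactly when
   the range of T is closed; below T has finite rank. *)
Definition is_mp_inverse A B T (G : V -> V) : Prop :=
  [/\ bounded_operator B A G,
      forall x, carrier A x -> T (G (T x)) = T x,
      forall y, carrier B y -> G (T (G y)) = G y,
      is_adjoint B B (T \o G) (T \o G) &
      is_adjoint A A (G \o T) (G \o T)].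

Definition mp_inverse A B T : V -> V :=
  xget (cst 0) [set G | is_mp_inverse A B T G].

Definition orthproj A D (x : V) : V := xget 0
  [set p | D p /\ forall q, D q -> dot A (x - p) q = 0].

(* Families are indexed by a set J of natural numbers, so that finite
   dimensional spaces are covered. *)
Definition sums_to A J (u : nat -> V) (x : V) : Prop :=
  tends A (fun n => \sum_(j < n | (j : nat) \in J) u j) x.

Definition orthonormal_family A J e : Prop :=
  (forall j, J j -> carrier A (e j)) /\
  forall j k, J j -> J k -> dot A (e j) (e k) = (j == k)%:R.

Definition orthonormal_basis A J e : Prop :=
  orthonormal_family A J e /\
  forall x, carrier A x -> sums_to A J (fun j => dot A x (e j) *: e j) x.

Definition eigenspace A T (mu : R) : set V :=
  [set x | carrier A x /\ T x = mu *: x].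

Definition eigenvalue A T (mu : R) : Prop :=
  exists2 x, eigenspace A T mu x & x != 0.

(* Exactly h eigenvalues are larger than mu, so h counts from 0. *)
Definition nth_distinct_eigenvalue A T (h : nat) (mu : R) : Prop :=
  eigenvalue A T mu /\ ([set nu | eigenvalue A T nu /\ mu < nu] #= `I_h)%card.

(* This is 0 when T has at most h distinct eigenvalues. *)
Definition eigenprojection A T (h : nat) : V -> V := orthproj A
  [set x | x = 0 \/
     exists2 mu, nth_distinct_eigenvalue A T h mu & eigenspace A T mu x].

Definition eigenbasis A T J phi lam : Prop :=
  [/\ forall j k, (j <= k)%N -> J k -> J j,
      orthonormal_basis A J phi,
      forall j, J j -> T (phi j) = lam j *: phi j,
      forall j k, (j <= k)%N -> J k -> lam k <= lam j &
      forall j, J j -> 0 < lam j].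

(* l lists the positive eigenvalues of T in decreasing order, each as often as
   the dimension of its eigenspace, and continues with 0 if they run out. *)
Definition is_eigenvalue_list A T l : Prop :=
  [/\ nonincreasing_seq l, forall j, 0 <= l j &
      forall mu, 0 < mu -> exists e : nat -> V,
        orthonormal_basis (ip_restrict A (eigenspace A T mu))
          [set j | l j = mu] e].

Definition eigenvalues A T : nat -> R :=
  xget (cst 0) [set l | is_eigenvalue_list A T l].

(* T = \sum_k rho_k (g_k \otimes f_k) with (g \otimes f) x = <g, x> f; the
   vectors g_k, f_k matter only when rho_k != 0. *)
Definition is_svd A B T rho (g f : nat -> V) : Prop :=
  [/\ nonincreasing_seq rho, rho @ \oo --> 0,
      orthonormal_family A [set k | rho k != 0] g,
      orthonormal_family B [set k | rho k != 0] f &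
      forall x, carrier A x ->
        sums_to B setT (fun k => rho k *: (dot A (g k) x *: f k)) (T x)].

Definition has_svd A B T : Prop := exists rho g f, is_svd A B T rho g f.

(* S_i(m) = S_i (P_i1 + ... + P_im) *)
Definition truncation A T (m : nat) (x : V) : V :=
  T (\sum_(h < m) eigenprojection A T h x).

(* The inner product is the polarization of \sum_j <f, phi_j>^2 / lam_j. *)
Definition rkhs A T J phi lam : ipSpace V := IPSpace
  [set f | exists2 g, carrier A g & f = op_sqrt A T g]
  (fun f g => limn (fun n =>
     \sum_(j < n | (j : nat) \in J) dot A f (phi j) * dot A g (phi j) / lam j)).

Definition is_Gamma A J phi lam (Gamma : V -> V) : Prop :=
  forall g, carrier A g -> sums_to A J
    (fun j => (Num.sqrt (lam j) * dot A g (phi j)) *: phi j) (Gamma g).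

End hilbert.

Section random_elements.
Context {dO} {Omega : measurableType dO} {R : realType} {V : lmodType R}.
Variables (P : probability Omega R) (A : ipSpace V).

Definition random_element (X : Omega -> V) : Prop :=
  (forall w, carrier A (X w)) /\
  forall U, ipopen A U -> measurable (X @^-1` U).

(* E[Y] = y in the weak sense *)
Definition has_mean (Y : Omega -> V) (y : V) : Prop := carrier A y /\
  forall g, carrier A g ->
    P.-integrable setT (fun w => (dot A (Y w) g)%:E) /\
    ('E_P[fun w => dot A (Y w) g] = (dot A y g)%:E)%E.

(* S = E[X \otimes X] *)
Definition is_covariance (X : Omega -> V) (S : V -> V) : Prop :=
  bounded_operator A A S /\
  forall h, carrier A h -> has_mean (fun w => dot A (X w) h *: X w) (S h).

End random_elements.

(* Main.v *)
(** By [Gamma_i], [T] becomes [C : H_2 -> H_1], and [T(m)] becomes the compression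
    [Pi_1(m) C Pi_2(m)], where [Pi_i(m)] is the projection on the eigenvectors of
    [S_i] for the [m] largest distinct eigenvalues; these are finitely many since
    [S] has finite trace.  The Courant-Fischer principle then gives monotonicity,
    because [Pi_1(m) C Pi_2(m)] is a compression of [Pi_1(n) C Pi_2(n)] for
    [m <= n] and of [C], and gives convergence, because the quadratic form of
    [T(m) T(m)^*] converges on the span of the first [j + 1] eigenvectors of
    [T T^*].  The bound by [1] is the Cauchy-Schwarz inequality for the form
    [<S x, y>]. *)

Require Import Defs.
From HB Require Import structures.
From mathcomp Require Import all_boot all_order all_algebra finmap ring lra.
From mathcomp Require Import all_classical all_reals all_analysis measurable_realfun.
Set Implicit Arguments.
Unset Strict Implicit.
Unset Printing Implicit Defensive.
Import Order.TTheory GRing.Theory Num.Theory.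
Import numFieldNormedType.Exports.
Local Open Scope classical_set_scope.
Local Open Scope ring_scope.

(** * Inner products and orthonormal families *)

(** Square roots, pseudo-inverses, projections and eigenvalue lists are values of the choice [xget],
    which falls back on a default when nothing qualifies, so each needs existence and uniqueness
    before it can be computed. The operators that live on a single block multiply coordinates in its
    eigenbasis, which turns these questions into statements about numbers. Eigenvalue lists are
    obtained from expansions [is_svd A A K l e e]: for C C' from the given singular value
    decomposition, for the compressions from the spectral theorem for real symmetric matrices. Two
    compressions are compared only on the range of the smaller projection, which suffices because
    that range contains the relevant eigenvectors. For the limit, weak convergence is enough: on the
    span of finitely many vectors a form is governed by finitely many entries. The inverse roots of
    S_1 and S_2 may be unbounded, so the Cauchy-Schwarz inequality for S is applied to finite
    combinations and limits are taken afterwards. *)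

Section semidefinite_forms.
Context {R : realType} {V : lmodType R}.

Record semidefinite (q : V -> V -> R) : Prop := Semidefinite {
  form_sym : forall x y, q x y = q y x ;
  form_lin : forall a x y z, q (a *: x + y) z = a * q x z + q y z ;
  form_ge0 : forall x, 0 <= q x x }.

Variables (q : V -> V -> R) (q_semi : semidefinite q).

Lemma formDl x y z : q (x + y) z = q x z + q y z.
Proof. by have := form_lin q_semi 1 x y z; rewrite scale1r mul1r. Qed.

Lemma form0l z : q 0 z = 0.
Proof. by apply: (addrI (q 0 z)); rewrite -formDl !addr0. Qed.

Lemma formZl a x z : q (a *: x) z = a * q x z.
Proof. by have := form_lin q_semi a x 0 z; rewrite addr0 form0l addr0. Qed.

Lemma formNl x z : q (- x) z = - q x z.
Proof. by rewrite -scaleN1r formZl mulN1r. Qed.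

Lemma formBl x y z : q (x - y) z = q x z - q y z.
Proof. by rewrite formDl formNl. Qed.

Lemma form0r z : q z 0 = 0.
Proof. by rewrite form_sym// form0l. Qed.

Lemma formDr x y z : q z (x + y) = q z x + q z y.
Proof. by rewrite form_sym// formDl !(form_sym q_semi z). Qed.

Lemma formZr a x z : q z (a *: x) = a * q z x.
Proof. by rewrite form_sym// formZl (form_sym q_semi z). Qed.

Lemma formNr x z : q z (- x) = - q z x.
Proof. by rewrite form_sym// formNl (form_sym q_semi z). Qed.

Lemma formBr x y z : q z (x - y) = q z x - q z y.
Proof. by rewrite formDr formNr. Qed.

Lemma form_suml I (r : seq I) (p : pred I) (u : I -> V) z :
  q (\sum_(i <- r | p i) u i) z = \sum_(i <- r | p i) q (u i) z.
Proof.
by apply: (big_morph (q ^~ z)) => [x y|]; [exact: formDl | exact: form0l].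
Qed.

Lemma form_sumr I (r : seq I) (p : pred I) (u : I -> V) z :
  q z (\sum_(i <- r | p i) u i) = \sum_(i <- r | p i) q z (u i).
Proof.
by rewrite form_sym// form_suml; apply: eq_bigr => i _; rewrite form_sym.
Qed.

(** The quadratic t -> q (t x + y) (t x + y) is nonnegative and is evaluated at its minimiser - q x
    y / q x x. If q x x = 0 it is affine in t, and a nonzero slope 2 q x y would let it take the
    value -1. *)
Lemma form_cauchy_schwarz x y : q x y ^+ 2 <= q x x * q y y.
Proof.
have h t : 0 <= q x x * t ^+ 2 + 2 * t * q x y + q y y.
  have := form_ge0 q_semi (t *: x + y).
  rewrite !(formDl, formDr, formZl, formZr) (form_sym q_semi y x).
  by move=> h; apply: (le_trans h); rewrite le_eqVlt; apply/orP; left; apply/eqP; ring.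
have [x0|x0] := eqVneq (q x x) 0.
  have [->|xy0] := eqVneq (q x y) 0; first by rewrite expr0n x0 mul0r.
  have := h (- (q y y + 1) / (2 * q x y)).
  have -> : q x x * (- (q y y + 1) / (2 * q x y)) ^+ 2 +
      2 * (- (q y y + 1) / (2 * q x y)) * q x y + q y y = -1.
    by rewrite x0; field.
  by rewrite oppr_ge0 leNgt ltr01.
have xp : 0 < q x x by rewrite lt_def x0 form_ge0.
have := h (- q x y / q x x).
have -> : q x x * (- q x y / q x x) ^+ 2 + 2 * (- q x y / q x x) * q x y + q y y =
    (q x x * q y y - q x y ^+ 2) / q x x by field.
by rewrite pmulr_lge0 ?invr_gt0// subr_ge0.
Qed.

End semidefinite_forms.

Section inner_product.
Context {R : realType} {V : lmodType R}.

(** The form is bilinear and definite on all of [V], so passing to a subspace changes only the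
    carrier. The reproducing kernel spaces, whose product is a limit, are reached through isometries
    instead. *)
Record inner_product (A : ipSpace V) : Prop := InnerProduct {
  ip_form : semidefinite (dot A) ;
  ip_def : forall x, dot A x x = 0 -> x = 0 ;
  carrier0 : carrier A 0 ;
  carrier_lin : forall a x y, carrier A x -> carrier A y ->
    carrier A (a *: x + y) }.

Variables (A : ipSpace V) (hA : inner_product A).
Local Notation "<[ x , y ]>" := (dot A x y) (at level 0, format "<[ x ,  y ]>").
Local Notation N := (ipnorm A).
Let hq := ip_form hA.

Definition dotC := form_sym hq.
Definition dotDl := formDl hq.
Definition dotDr := formDr hq.
Definition dotZl := formZl hq.
Definition dotZr := formZr hq.
Definition dotBl := formBl hq.
Definition dotBr := formBr hq.
Definition dot0l := form0l hq.
Definition dot0r := form0r hq.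
Definition dot_suml := form_suml hq.
Definition dot_sumr := form_sumr hq.

Lemma carrierD x y : carrier A x -> carrier A y -> carrier A (x + y).
Proof. by move=> Ax Ay; rewrite -[x]scale1r; apply: carrier_lin. Qed.

Lemma carrierZ a x : carrier A x -> carrier A (a *: x).
Proof.
by move=> Ax; rewrite -[a *: x]addr0; apply: carrier_lin => //; apply: carrier0.
Qed.

Lemma carrierB x y : carrier A x -> carrier A y -> carrier A (x - y).
Proof. by move=> Ax Ay; apply: carrierD => //; rewrite -scaleN1r; apply: carrierZ. Qed.

Lemma carrier_sum I (r : seq I) (p : pred I) (u : I -> V) :
  (forall i, p i -> carrier A (u i)) -> carrier A (\sum_(i <- r | p i) u i).
Proof. by move=> h; apply: big_ind => //; [exact: carrier0 | exact: carrierD]. Qed.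

Lemma ipnorm_ge0 x : 0 <= N x. Proof. exact: sqrtr_ge0. Qed.

Lemma ipnorm_sqr x : N x ^+ 2 = <[x, x]>.
Proof. by rewrite sqr_sqrtr// (form_ge0 hq). Qed.

Lemma ipnorm0 : N 0 = 0.
Proof. by rewrite /ipnorm dot0l sqrtr0. Qed.

Lemma cauchy_schwarz x y : `|<[x, y]>| <= N x * N y.
Proof.
rewrite -(@ler_pXn2r _ 2)// ?nnegrE ?mulr_ge0 ?ipnorm_ge0//.
by rewrite exprMn !ipnorm_sqr real_normK ?num_real// (form_cauchy_schwarz hq).
Qed.

Lemma ipnormZ a x : N (a *: x) = `|a| * N x.
Proof.
by rewrite /ipnorm dotZl dotZr mulrA -expr2 sqrtrM ?sqr_ge0// sqrtr_sqr.
Qed.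

Lemma ipnormN x : N (- x) = N x.
Proof. by rewrite -scaleN1r ipnormZ normrN1 mul1r. Qed.

Lemma ler_ipnormD x y : N (x + y) <= N x + N y.
Proof.
rewrite -(@ler_pXn2r _ 2)// ?nnegrE ?addr_ge0 ?ipnorm_ge0//.
rewrite ipnorm_sqr !(dotDl, dotDr) (dotC y x) -!ipnorm_sqr.
have := le_trans (ler_norm _) (cauchy_schwarz x y).
by move=> h; rewrite sqrrD; lra.
Qed.

Lemma ip_eq x y : carrier A x -> carrier A y ->
  (forall z, carrier A z -> <[x, z]> = <[y, z]>) -> x = y.
Proof.
move=> Ax Ay h; apply/eqP; rewrite -subr_eq0; apply/eqP/(ip_def hA).
by rewrite dotBl h ?subrr//; apply: carrierB.
Qed.

Lemma tends_dot u x y : tends A u x -> <[u n, y]> @[n --> \oo] --> <[x, y]>.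
Proof.
move=> ux; apply/subr_cvg0; apply: norm_cvg0.
apply: (@squeeze_cvgr _ _ _ _ (cst 0) (fun n => N (u n - x) * N y)).
- by apply: nearW => n /=; rewrite normr_ge0/= -dotBl cauchy_schwarz.
- exact: cvg_cst.
- by rewrite -[X in _ --> X](mul0r (N y)); apply: cvgMl.
Qed.
Arguments tends_dot {u x} y.

Lemma tends_unique u x y : tends A u x -> tends A u y -> x = y.
Proof.
move=> ux uy; apply/eqP; rewrite -subr_eq0; apply/eqP/(ip_def hA).
have h := tends_dot (x - y) ux; have h' := tends_dot (x - y) uy.
by rewrite dotBl (cvg_unique _ h h')// subrr.
Qed.

Lemma tends_ipnorm u x : tends A u x -> N (u n) @[n --> \oo] --> N x.
Proof.
move=> ux; apply/subr_cvg0; apply: norm_cvg0.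
apply: (@squeeze_cvgr _ _ _ _ (cst 0) (fun n => N (u n - x))) => //; last first.
  exact: cvg_cst.
apply: nearW => n /=; rewrite normr_ge0/= ler_norml.
have := ler_ipnormD (u n - x) x; have := ler_ipnormD (- (u n - x)) (u n).
by rewrite ipnormN subrK opprB subrK; lra.
Qed.

Lemma tends_dominated (a : R^nat) u x : a @ \oo --> 0 ->
  (forall n, N (u n - x) <= a n) -> tends A u x.
Proof.
move=> a0 h; apply: (@squeeze_cvgr _ _ _ _ (cst 0) a) => //.
- by apply: nearW => n /=; rewrite ipnorm_ge0 h.
- exact: cvg_cst.
Qed.

Lemma sums_to_dot J u x y : sums_to A J u x ->
  \sum_(j < n | (j : nat) \in J) <[u j, y]> @[n --> \oo] --> <[x, y]>.
Proof.
by move=> /(tends_dot y); under eq_fun do rewrite dot_suml.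
Qed.
Arguments sums_to_dot {J u x} y.

Section orthonormal.
Variables (J : set nat) (e : nat -> V).

Section family.
Hypothesis he : orthonormal_family A J e.

Lemma dot_orthonormal_sum (c : nat -> R) n k : J k ->
  <[\sum_(j < n | (j : nat) \in J) c j *: e j, e k]> =
  if (k < n)%N then c k else 0.
Proof.
move=> Jk; rewrite dot_suml; case: ifPn => kn.
  rewrite (bigD1 (Ordinal kn))/= ?inE// dotZl he.2// eqxx mulr1 big1 ?addr0//.
  move=> j /andP[/set_mem Jj jk]; rewrite dotZl he.2//.
  by rewrite -(inj_eq val_inj)/= in jk; rewrite (negbTE jk) mulr0.
rewrite big1// => j /set_mem Jj; rewrite dotZl he.2//.
by case: eqP => [jk|]; rewrite ?mulr0//; rewrite -jk ltn_ord in kn.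
Qed.

Lemma ipnorm_orthonormal_sum (c : nat -> R) n :
  <[\sum_(j < n | (j : nat) \in J) c j *: e j,
    \sum_(j < n | (j : nat) \in J) c j *: e j]> =
  \sum_(j < n | (j : nat) \in J) c j ^+ 2.
Proof.
rewrite dot_sumr; apply: eq_bigr => j /set_mem Jj.
by rewrite dotZr dot_orthonormal_sum// ltn_ord expr2.
Qed.

Lemma bessel x n : \sum_(j < n | (j : nat) \in J) <[x, e j]> ^+ 2 <= <[x, x]>.
Proof.
pose y := \sum_(j < n | (j : nat) \in J) <[x, e j]> *: e j.
have xy : <[x, y]> = \sum_(j < n | (j : nat) \in J) <[x, e j]> ^+ 2.
  by rewrite dot_sumr; apply: eq_bigr => j _; rewrite dotZr expr2.
have := form_ge0 hq (x - y).
rewrite !(dotBl, dotBr) (dotC y x) xy (ipnorm_orthonormal_sum (fun j => <[x, e j]>)).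
lra.
Qed.

End family.

Section basis.
Hypothesis he : orthonormal_basis A J e.

(** Both vectors are limits of the same partial sums. Operator identities below are reduced to
    coordinates in this way. *)
Lemma basis_eq x y : carrier A x -> carrier A y ->
  (forall j, J j -> <[x, e j]> = <[y, e j]>) -> x = y.
Proof.
move=> Ax Ay h; apply: (tends_unique (he.2 x Ax)).
have := he.2 y Ay; rewrite /sums_to/=; congr tends; apply/funext => n.
by apply: eq_bigr => j /set_mem Jj; rewrite h.
Qed.

Lemma parseval x y : carrier A x ->
  \sum_(j < n | (j : nat) \in J) <[x, e j]> * <[y, e j]> @[n --> \oo]
    --> <[x, y]>.
Proof.
move=> Ax; have := sums_to_dot y (he.2 x Ax).
by under eq_fun do under eq_bigr do rewrite dotZl (dotC _ y).
Qed.

End basis.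
End orthonormal.

End inner_product.

Arguments tends_dot {R V A} hA {u x} y.
Arguments sums_to_dot {R V A} hA {J u x} y.

Section linear_on_carriers.
Context {R : realType} {V : lmodType R}.
Variables (A : ipSpace V) (hA : inner_product A) (K : V -> V).
Hypothesis K_lin : forall a x y, carrier A x -> carrier A y ->
  K (a *: x + y) = a *: K x + K y.

Lemma linear_sum I (r : seq I) (c : I -> R) (u : I -> V) :
  (forall i, carrier A (u i)) ->
  K (\sum_(i <- r) c i *: u i) = \sum_(i <- r) c i *: K (u i).
Proof.
move=> Au; elim: r => [|i r IH].
  have A0 := carrier0 hA; rewrite !big_nil.
  by have := K_lin (-1) A0 A0; rewrite !scaleN1r addr0 oppr0 addNr.
rewrite !big_cons K_lin ?IH//; apply: (carrier_sum hA) => k _.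
exact: (carrierZ hA).
Qed.

End linear_on_carriers.

Section limits.
Context {R : realType}.
Implicit Types (u : R^nat) (a b : R).

Lemma cvg_leP u a b : u @ \oo --> a -> (forall n, u n <= b) -> a <= b.
Proof.
move=> ua h; rewrite -(cvg_lim (@norm_hausdorff _ _) ua); apply: limr_le.
  by apply/cvg_ex; exists a.
exact: nearW.
Qed.

Lemma cvg_eventually_cst (T : topologicalType) (u : nat -> T) N (a : T) :
  (forall n, (N <= n)%N -> u n = a) -> u @ \oo --> a.
Proof.
move=> h; apply: (cvg_trans _ (@cvg_cst _ a _ \oo _)).
by apply: near_eq_cvg; exists N => // n /= /h.
Qed.

End limits.

Section kernel.

Lemma kernel_vector (F : fieldType) m n (M : 'M[F]_(m, n)) : (n < m)%N ->
  exists2 v : 'rV_m, v != 0 & v *m M = 0.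
Proof.
move=> nm; have K0 : kermx M != 0.
  by rewrite -mxrank_eq0 mxrank_ker -lt0n subn_gt0 (leq_ltn_trans (rank_leq_col M)).
exists (nz_row (kermx M)); first by rewrite nz_row_eq0.
by apply/sub_kermxP/nz_row_sub.
Qed.

End kernel.

(** * Singular values and eigenvalue lists *)

Section singular_values.
Context {R : realType} {V : lmodType R}.
Implicit Types (A B : ipSpace V) (T K : V -> V).

Lemma tendsZ A (hA : inner_product A) a u x : tends A u x ->
  tends A (fun n => a *: u n) (a *: x).
Proof.
move=> ux; have : (fun n => `|a| * ipnorm A (u n - x)) @ \oo --> `|a| * 0.
  exact: cvgMr.
rewrite mulr0; apply: cvg_trans; apply: near_eq_cvg; apply: nearW => n /=.
by rewrite -scalerBr (ipnormZ hA).
Qed.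

(** [is_svd] states no sign; a nonincreasing sequence stays above its limit, here 0. *)
Lemma svd_ge0 A B T rho g f : is_svd A B T rho g f -> forall k, 0 <= rho k.
Proof.
move=> [dec lim _ _ _] k.
rewrite -(cvg_lim (@norm_hausdorff _ _) lim) nonincreasing_cvgn_ge//.
by apply/cvg_ex; exists 0.
Qed.

Section svd.
Variables (A B : ipSpace V) (hA : inner_product A) (hB : inner_product B).
Variables (T : V -> V) (rho : nat -> R) (g f : nat -> V).
Hypothesis hT : is_svd A B T rho g f.

Lemma svd_dot x y : carrier A x ->
  \sum_(k < n) rho k * (dot A (g k) x * dot B (f k) y) @[n --> \oo]
    --> dot B (T x) y.
Proof.
case: hT => _ _ _ _ h Ax; have := sums_to_dot hB y (h x Ax).
apply: cvg_trans; apply: near_eq_cvg; apply: nearW => n /=.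
apply: eq_big => [i|i _]; first by rewrite in_setT.
by rewrite !(dotZl hB).
Qed.

Lemma svd_singular k : rho k != 0 -> T (g k) = rho k *: f k.
Proof.
move=> k0; have [_ _ hg _ h] := hT.
apply: (tends_unique hB (h (g k) (hg.1 k k0))).
apply: (@cvg_eventually_cst _ _ k.+1) => n kn.
rewrite (bigD1 (Ordinal kn)) ?in_setT//= hg.2// eqxx scale1r big1.
  by rewrite addr0 subrr (ipnorm0 hB).
(* [g j] is unconstrained where [rho j = 0], but there the coefficient vanishes. *)
move=> j /andP[_ jk]; have [->|j0] := eqVneq (rho j) 0; first by rewrite scale0r.
by rewrite -(inj_eq val_inj)/= in jk; rewrite hg.2// (negbTE jk) scale0r scaler0.
Qed.

Lemma svd_coef x k : carrier A x -> rho k != 0 ->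
  dot B (T x) (f k) = rho k * dot A (g k) x.
Proof.
move=> Ax k0; have [_ _ _ hf _] := hT.
apply: (cvg_unique _ (svd_dot (y := f k) Ax)) => //.
apply: (@cvg_eventually_cst _ _ k.+1) => n kn.
rewrite (bigD1 (Ordinal kn))//= hf.2// eqxx mulr1 big1 ?addr0//.
move=> j jk; have [->|j0] := eqVneq (rho j) 0; first by rewrite mul0r.
by rewrite -(inj_eq val_inj)/= in jk; rewrite hf.2// (negbTE jk) !mulr0.
Qed.

(** Since <g_k, T' y> = <T g_k, y> = rho_k <f_k, y>, the expansion of [T] at [T' y] is term by term
    the diagonal expansion of [T \o T']. *)
Lemma svd_gram T' : is_adjoint A B T T' ->
  is_svd B B (T \o T') (fun k => rho k ^+ 2) f f.
Proof.
move=> [T'A adj]; have [dec lim hg hf h] := hT.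
have nz : [set k | rho k ^+ 2 != 0] = [set k | rho k != 0].
  by apply/seteqP; split=> k /=; rewrite expf_eq0.
split; rewrite ?nz//.
- by move=> i j ij; apply: lerXn2r; rewrite ?nnegrE ?(svd_ge0 hT)//; exact: dec.
- by rewrite -[X in _ --> X](mulr0 0); apply: cvgM.
move=> y By; have := h _ (T'A y By); congr tends; apply/funext => n.
apply: eq_bigr => k _; have [->|k0] := eqVneq (rho k) 0.
  by rewrite expr0n !scale0r.
rewrite -adj//; last exact: hg.1.
by rewrite svd_singular// (dotZl hB) expr2 scalerA scalerA mulrA.
Qed.

End svd.

Section eigenvalue_lists.
Variables (A : ipSpace V) (hA : inner_product A) (K : V -> V).

Section list_of_svd.
Variables (l : nat -> R) (e : nat -> V) (hK : is_svd A A K l e e).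

(** If K x = mu x, comparing coefficients gives (mu - l_j) <e_j, x> = 0. So [x] only meets the [e j]
    with [l j = mu], and its expansion is that of [K x] divided by [mu]. *)
Lemma svd_eigenvalue_list : is_eigenvalue_list A K l.
Proof.
have [dec lim he _ h] := hK; split=> //; first exact: (svd_ge0 hK).
move=> mu mu0; exists e.
have nz k : l k = mu -> l k != 0 by move=> ->; rewrite gt_eqF.
split; first split=> [j /= lj|j k /= lj lk].
- by split; [exact: he.1 (nz _ lj) | rewrite (svd_singular hA hK) ?nz// lj].
- by apply: he.2; exact: nz.
move=> x [Ax Kx] /=.
have := tendsZ hA mu^-1 (h x Ax).
rewrite Kx scalerA mulVf ?gt_eqF// scale1r; congr tends; apply/funext => n.
rewrite scaler_sumr [RHS]big_mkcond/=; apply: eq_big => [j|j _].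
  by rewrite in_setT.
case: ifPn => [/set_mem/= lj|/negP lj].
  by rewrite lj !scalerA mulrA mulVf ?gt_eqF// mul1r (dotC hA).
have [->|l0] := eqVneq (l j) 0; first by rewrite scale0r scaler0.
suff -> : dot A (e j) x = 0 by rewrite scale0r !scaler0.
have := svd_coef hA hK Ax l0; rewrite Kx (dotZl hA) (dotC hA x) => /eqP.
rewrite -subr_eq0 -mulrBl mulf_eq0 => /orP[|/eqP//].
by rewrite subr_eq0 => /eqP muj; case: lj; rewrite inE /= muj.
Qed.

(** The upper half of Courant-Fischer: in <K x, x> = sum_k l_k <x, e_k>^2 the terms below [j]
    vanish, the others are at most l_j <x, e_k>^2, and Bessel bounds their sum. *)
Lemma svd_form_le j x : carrier A x ->
  (forall k, (k < j)%N -> l k != 0 -> dot A x (e k) = 0) ->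
  dot A (K x) x <= l j * dot A x x.
Proof.
move=> Ax hx; have [dec _ he _ _] := hK.
apply: (cvg_leP (svd_dot hA hK (y := x) Ax)) => n.
apply: (@le_trans _ _ (l j *
    \sum_(k < n | (k : nat) \in [set k | l k != 0]) dot A x (e k) ^+ 2)); last first.
  by rewrite ler_wpM2l ?(svd_ge0 hK)// (bessel hA he).
rewrite mulr_sumr [leRHS]big_mkcond/=; apply: ler_sum => k _.
rewrite -expr2 (dotC hA).
case: ifPn => [/set_mem/= k0|]; last first.
  by rewrite notin_setE/= => /negP; rewrite negbK => /eqP->; rewrite mul0r.
have [kj|jk] := ltnP k j; first by rewrite hx// expr0n !mulr0.
by rewrite ler_wpM2r ?sqr_ge0//; apply: dec.
Qed.

(* Courant-Fischer: some combination of the [u i] is orthogonal to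
   [e 0, ..., e (j-1)]. *)
Lemma svd_minmax j (u : 'I_j.+1 -> V) c : (forall i, carrier A (u i)) ->
  (forall i k, dot A (u i) (u k) = (i == k)%:R) ->
  (forall a : 'I_j.+1 -> R, let x := \sum_i a i *: u i in
    c * (\sum_i a i ^+ 2) <= dot A (K x) x) ->
  c <= l j.
Proof.
move=> Au uu hc.
(* Each column is one condition on the j + 1 coefficients; it is void when [l k = 0], where
   [svd_form_le] asks for nothing. *)
pose M : 'M[R]_(j.+1, j) :=
  \matrix_(i, k) if l k == 0 then 0 else dot A (u i) (e k).
have [v v0 vM] := kernel_vector M (ltnSn j).
pose x := \sum_i v 0 i *: u i.
have Ax : carrier A x by apply: (carrier_sum hA) => i _; apply: (carrierZ hA).
have xx : dot A x x = \sum_i v 0 i ^+ 2.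
  rewrite (dot_suml hA); apply: eq_bigr => i _; rewrite (dotZl hA) (dot_sumr hA).
  rewrite (bigD1 i)//= big1 ?addr0; first by rewrite (dotZr hA) uu eqxx mulr1 expr2.
  by move=> k ki; rewrite (dotZr hA) uu eq_sym (negbTE ki) mulr0.
have s0 : 0 < \sum_i v 0 i ^+ 2.
  rewrite lt_def sumr_ge0 ?andbT => [|i _]; last exact: sqr_ge0.
  apply: contra v0; rewrite psumr_eq0 => [|i _]; last exact: sqr_ge0.
  move=> /allP h; apply/eqP/rowP => i; rewrite mxE.
  by have := h i (mem_index_enum i); rewrite sqrf_eq0 => /eqP.
rewrite -(ler_pM2r s0); apply: (le_trans (hc (fun i => v 0 i))).
rewrite -xx; apply: svd_form_le => // k kj k0.
rewrite (dot_suml hA); have /rowP/(_ (Ordinal kj)) := vM.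
rewrite !mxE => {2}<-; apply: eq_bigr => i _.
by rewrite (dotZl hA) !mxE /= (negbTE k0).
Qed.

End list_of_svd.

End eigenvalue_lists.

(* Counting both orthonormal families by Bessel and Parseval. *)
Lemma orthonormal_count E (J J' : set nat) (e e' : nat -> V) N n : inner_product E ->
  (forall j, J j -> (j < N)%N) -> orthonormal_basis E J e ->
  orthonormal_family E J' e' ->
  (\sum_(j < n | (j : nat) \in J') 1 <= \sum_(i < N | (i : nat) \in J) 1)%N.
Proof.
move=> hE JN he he'.
suff : \sum_(j < n | (j : nat) \in J') 1 <=
       \sum_(i < N | (i : nat) \in J) (1 : R) by rewrite -(ler_nat R) !natr_sum.
apply: (@le_trans _ _ (\sum_(j < n | (j : nat) \in J')
    \sum_(i < N | (i : nat) \in J) dot E (e' j) (e i) ^+ 2)).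
  apply: ler_sum => j /set_mem Jj.
  have := parseval hE he (y := e' j) (he'.1 j Jj); rewrite he'.2// eqxx => h.
  apply: (cvg_leP h) => m.
  rewrite [leLHS](eq_bigr (fun i : 'I_m => dot E (e' j) (e i) ^+ 2)) => [|i _];
    last by rewrite expr2.
  rewrite (big_ord_widen_cond (maxn m N) (fun i => i \in J)
    (fun i => dot E (e' j) (e i) ^+ 2)) ?leq_maxl//.
  rewrite (big_ord_widen_cond (maxn m N) (fun i => i \in J)
    (fun i => dot E (e' j) (e i) ^+ 2) (leq_maxr m N)).
  rewrite big_mkcond [leRHS]big_mkcond/=; apply: ler_sum => i _.
  have [/set_mem/JN ->|] := boolP ((i : nat) \in J) => //=.
  by case: ifP => _ //; apply: sqr_ge0.
rewrite exchange_big/=; apply: ler_sum => i /set_mem Ji.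
have := bessel hE he' (e i) n; rewrite he.1.2// eqxx; apply: le_trans.
by apply: ler_sum => j _; rewrite (dotC hE).
Qed.

Lemma eigenspace_inner_product A K mu : inner_product A ->
  (forall a x y, carrier A x -> carrier A y -> K (a *: x + y) = a *: K x + K y) ->
  inner_product (ip_restrict A (Defs.eigenspace A K mu)).
Proof.
move=> hA lin; split=> [| | |a x y [Ax Kx] [Ay Ky]]; first exact: (ip_form hA).
- exact: (ip_def hA).
- split; first exact: (carrier0 hA).
  have := lin (-1) 0 0 (carrier0 hA) (carrier0 hA).
  by rewrite !scaleN1r addr0 oppr0 addNr scaler0.
- split; first exact: (carrier_lin hA).
  by rewrite lin// Kx Ky scalerDr !scalerA mulrC.
Qed.

(** At the first index [j] of disagreement, say l1 j < mu = l2 j. All occurrences of mu in l1 lie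
    below [j], where the lists agree, so l2 has at least one more, and its orthonormal family in the
    eigenspace of mu outnumbers the basis given by l1. *)
Lemma eigenvalue_list_unique A K l l' : inner_product A ->
  (forall a x y, carrier A x -> carrier A y -> K (a *: x + y) = a *: K x + K y) ->
  is_eigenvalue_list A K l -> is_eigenvalue_list A K l' -> l = l'.
Proof.
move=> hA lin; suff step l1 l2 : is_eigenvalue_list A K l1 ->
    is_eigenvalue_list A K l2 ->
    forall j, (forall i, (i < j)%N -> l1 i = l2 i) -> l2 j <= l1 j.
  move=> hl hl'; apply/funext => j; have [n] := ubnP j.
  elim: n j => // n IHn j jn; apply/eqP; rewrite eq_le.
  rewrite (step l l')// ?(step l' l)// => i ij;
    [apply/esym; apply: IHn | apply: IHn]; exact: (leq_trans ij).
move=> [dec1 pos1 b1] [dec2 pos2 b2] j eq12; rewrite leNgt; apply/negP => lt12.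
have mu0 : 0 < l2 j by exact: le_lt_trans (pos1 j) lt12.
have [e he] := b1 _ mu0; have [e' he'] := b2 _ mu0.
have hE := eigenspace_inner_product (l2 j) hA lin.
have Jj i : [set j0 | l1 j0 = l2 j] i -> (i < j)%N.
  move=> /= l1i; rewrite ltnNge; apply/negP => ji.
  by have := dec1 _ _ ji; rewrite l1i leNgt lt12.
have := orthonormal_count j.+1 hE Jj he he'.1.
rewrite big_mkcond big_ord_recr/= -big_mkcond/= mem_set// addn1.
rewrite (eq_bigl (fun i : 'I_j => (i : nat) \in [set j0 | l1 j0 = l2 j])) ?ltnn//.
by move=> i; apply/idP/idP; rewrite !inE/= => <-; rewrite eq12.
Qed.

Lemma eigenvalues_svd A K l e : inner_product A ->
  (forall a x y, carrier A x -> carrier A y -> K (a *: x + y) = a *: K x + K y) ->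
  is_svd A A K l e e -> eigenvalues A K = l.
Proof.
move=> hA lin hK; apply: xget_subset1; first exact: svd_eigenvalue_list hK.
by move=> l1 l2; apply: eigenvalue_list_unique.
Qed.

End singular_values.

(** * The spectral theorem for real symmetric matrices *)

Section symmetric_matrices.
Context {R : realType}.

Definition mxform n (M : 'M[R]_n) (v w : 'rV[R]_n) : R := (v *m M *m w^T) 0 0.

Lemma mxformE n (M : 'M[R]_n) v w :
  mxform M v w = \sum_j (\sum_i v 0 i * M i j) * w 0 j.
Proof. by rewrite /mxform mxE; apply: eq_bigr => j _; rewrite !mxE. Qed.

Lemma mxform1 n (v w : 'rV[R]_n) : mxform 1%:M v w = \sum_i v 0 i * w 0 i.
Proof. by rewrite /mxform mulmx1 mxE; apply: eq_bigr => i _; rewrite mxE. Qed.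

Lemma mxform1_ge0 n (v : 'rV[R]_n) : 0 <= mxform 1%:M v v.
Proof. by rewrite mxform1 sumr_ge0// => i _; rewrite -expr2 sqr_ge0. Qed.

Lemma mxform1_eq0 n (v : 'rV[R]_n) : mxform 1%:M v v = 0 -> v = 0.
Proof.
rewrite mxform1 => /eqP; rewrite psumr_eq0 => [|i _]; last by rewrite -expr2 sqr_ge0.
move=> /allP h; apply/rowP => i; have := h i (mem_index_enum i).
by rewrite mxE mulf_eq0 orbb => /eqP.
Qed.

Lemma mxformZ n (M : 'M[R]_n) a v : mxform M (a *: v) (a *: v) = a ^+ 2 * mxform M v v.
Proof.
by rewrite /mxform linearZ/= -!scalemxAl -scalemxAr scalerA !mxE expr2.
Qed.

Lemma mxform_continuous n (M : 'M[R]_n) : continuous (fun v => mxform M v v).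
Proof.
rewrite (_ : (fun v => _) =
    (fun v : 'rV[R]_n => \sum_j (\sum_i v 0 i * M i j) * v 0 j)); last first.
  by apply/funext => v; exact: mxformE.
have cc j : continuous (fun v : 'rV[R]_n => v 0 j) by exact: coord_continuous.
apply: continuous_big => [|j _]; first exact: add_continuous.
move=> v; apply: continuousM; last exact: cc.
apply: continuous_big => [|i _ w]; first exact: add_continuous.
by apply: continuousM; [exact: cc | exact: cst_continuous].
Qed.

(** The unit sphere is compact, so the form attains a maximum on it; scaling extends the bound to
    all [v]. *)
Lemma mxform_max n (M : 'M[R]_n.+1) : exists u, mxform 1%:M u u = 1 /\
  forall v, mxform M v v <= mxform M u u * mxform 1%:M v v.
Proof.
pose S := [set v : 'rV[R]_n.+1 | mxform 1%:M v v = 1].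
have [] := @EVT_max_rV R n.+1 (fun v => mxform M v v) S.
- exists (delta_mx 0 0); rewrite /S /= mxform1 (bigD1 0)//= big1 ?addr0.
    by rewrite mxE !eqxx mulr1.
  by move=> i i0; rewrite mxE (negbTE i0) mul0r.
- apply: bounded_closed_compact.
    (* The matrix norm is the largest absolute value of an entry, at most 1 on the Euclidean
       sphere. *)
    exists 1; split => // x x1 v /= Sv; apply: ltW; apply: le_lt_trans x1.
    rewrite [leLHS]/Num.Def.normr /= mx_normrE; apply/bigmax_leP; split => // -[i j] _ /=.
    rewrite ord1 -(@ler_pXn2r _ 2)// ?nnegrE// expr1n -Sv mxform1.
    by rewrite real_normK ?num_real// (bigD1 j)//= -expr2 lerDl sumr_ge0// => k _;
      rewrite -expr2 sqr_ge0.
  apply: (@closed_comp _ _ (fun v => mxform 1%:M v v) [set 1]); last exact: closed_eq.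
  by move=> x _; exact: mxform_continuous.
- by apply: continuous_subspaceT; exact: mxform_continuous.
move=> u /set_mem Su hu; exists u; split => // v.
have [v0|v0] := eqVneq (mxform 1%:M v v) 0.
  by rewrite (mxform1_eq0 v0) /mxform !mul0mx mxE mulr0.
have vp : 0 < mxform 1%:M v v by rewrite lt_def v0 mxform1_ge0.
have s2 : (Num.sqrt (mxform 1%:M v v))^-1 ^+ 2 = (mxform 1%:M v v)^-1.
  by rewrite exprVn sqr_sqrtr// ltW.
have := hu ((Num.sqrt (mxform 1%:M v v))^-1 *: v).
rewrite inE /S /= !mxformZ s2 mulVf// => /(_ erefl).
by rewrite mulrC ler_pdivrMr.
Qed.

(** For the maximiser [u] with value [a], the form of a - M is semidefinite and vanishes at (u, u).
    By Cauchy-Schwarz it vanishes at (u, w) for every w, that is u (a - M) = 0. *)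
Lemma symmetric_eigenvector n (M : 'M[R]_n.+1) : M^T = M -> exists u,
  [/\ mxform 1%:M u u = 1, u *m M = mxform M u u *: u &
      forall v, mxform M v v <= mxform M u u * mxform 1%:M v v].
Proof.
move=> Msym; have [u [u1 umax]] := mxform_max M; exists u; split=> //.
set a := mxform M u u in umax *.
pose p v w := mxform (a%:M - M) v w.
have pE v w : p v w = a * mxform 1%:M v w - mxform M v w.
  rewrite /p /mxform mulmxBr mulmxBl mul_mx_scalar mulmx1 -scalemxAl.
  by rewrite mxE [X in X + _ = _]mxE [X in _ + X = _]mxE.
have psemi : semidefinite p.
  split=> [v w|b v w z|v].
  - rewrite /p /mxform; set N := _ - M.
    have -> : v *m N *m w^T = (w *m N *m v^T)^T; last by rewrite mxE.
    by rewrite !trmx_mul trmxK [N^T]linearB/= tr_scalar_mx Msym mulmxA.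
  - rewrite /p /mxform !mulmxDl -!scalemxAl mxE.
    by rewrite [X in X + _ = _]mxE.
  - by rewrite pE subr_ge0.
have pu : p u u = 0 by rewrite pE u1 mulr1 subrr.
have pu0 w : p u w = 0.
  apply/eqP; rewrite -sqrf_eq0 eq_le sqr_ge0 andbT.
  by rewrite -[leRHS](mul0r (p w w)) -pu form_cauchy_schwarz.
apply/esym/eqP; rewrite -subr_eq0; apply/eqP/mxform1_eq0.
rewrite /mxform mulmx1; have := pu0 (a *: u - u *m M).
by rewrite /p /mxform mulmxBr mul_mx_scalar.
Qed.

(* Householder reflection. *)
Lemma orthogonal_row n (u : 'rV[R]_n.+1) : mxform 1%:M u u = 1 ->
  exists2 H : 'M[R]_n.+1, H *m H^T = 1%:M & delta_mx 0 0 *m H = u.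
Proof.
move=> u1; pose e0 : 'rV[R]_n.+1 := delta_mx 0 0.
have [->|ue] := eqVneq u e0; first by exists 1%:M; rewrite ?trmx1 mulmx1.
(* The reflection 1 - 2 w^T w / |w|^2 exchanges the unit vectors [e0] and [u]. Here c = |w|^2 = 2 (1
   - u_0), whence <e0, w> = c / 2. *)
pose w := e0 - u; pose c := mxform 1%:M w w.
have c0 : c != 0.
  by apply: contra ue => /eqP/mxform1_eq0/eqP; rewrite subr_eq0 eq_sym.
have wwT : w *m w^T = c%:M by rewrite [LHS]mx11_scalar /c /mxform mulmx1.
have e0u : e0 *m u^T = (u 0 0)%:M.
  by rewrite [LHS]mx11_scalar -rowE !mxE.
have ue0 : u *m e0^T = (u 0 0)%:M by rewrite -[LHS]trmxK trmx_mul trmxK e0u tr_scalar_mx.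
have uu : u *m u^T = 1%:M by rewrite [LHS]mx11_scalar -u1 /mxform mulmx1.
have ee : e0 *m e0^T = 1%:M.
  rewrite [LHS]mx11_scalar; congr (scalar_mx _).
  by rewrite -rowE !mxE.
have cE : c = 2 * (1 - u 0 0).
  have /matrixP/(_ 0 0) := wwT; rewrite [in RHS]mxE mulr1n => <-.
  rewrite /w linearB/= mulmxBl !mulmxBr ee uu ue0 e0u.
  by rewrite !mxE /= !mulr1n; ring.
exists (1%:M - (2 / c) *: (w^T *m w)).
  have ZZ : (w^T *m w) *m (w^T *m w) = c *: (w^T *m w).
    by rewrite mulmxA -(mulmxA w^T) wwT mul_mx_scalar -scalemxAl.
  have ZT : (w^T *m w)^T = w^T *m w by rewrite trmx_mul trmxK.
  move: (w^T *m w) ZZ ZT => Z ZZ ZT.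
  rewrite [X in _ *m X]linearB/= trmx1 [(_ *: Z)^T]linearZ/= ZT.
  rewrite mulmxBr mulmx1 mulmxBl mul1mx -scalemxAl -scalemxAr ZZ.
  by apply/matrixP => i j; rewrite !mxE; field.
rewrite mulmxBr mulmx1 -scalemxAr mulmxA -/e0.
have -> : e0 *m w^T = (c / 2)%:M.
  rewrite /w linearB/= mulmxBr ee e0u.
  rewrite cE.
  by apply/matrixP => i j; rewrite !ord1 !mxE /= !mulr1n; field.
rewrite mul_scalar_mx scalerA (_ : 2 / c * (c / 2) = 1); last by field.
by rewrite scale1r /w opprB addrC subrK.
Qed.

(** Induction on the size: a reflection moves the top eigenvector to the first coordinate, symmetry
    makes the matrix block diagonal, and the lower block is diagonalised by induction. The rows of
    [U] are the eigenvectors. *)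
Theorem symmetric_spectral n (M : 'M[R]_n) : M^T = M ->
  exists (U : 'M[R]_n) (d : 'rV[R]_n),
    [/\ U *m U^T = 1%:M, U *m M = diag_mx d *m U &
        forall i j : 'I_n, (i <= j)%N -> d 0 j <= d 0 i].
Proof.
elim: n M => [M _|n IHn M Msym].
  by exists 0, 0; split=> [||[]//]; rewrite ?flatmx0// [LHS]flatmx0 [RHS]flatmx0.
have [u [u1 uM umax]] := symmetric_eigenvector Msym.
set a := mxform M u u in uM umax.
have [H HHT e0H] := orthogonal_row u1.
have HTH : H^T *m H = 1%:M by apply: mulmx1C.
pose A : 'M[R]_(1 + n) := H *m M *m H^T.
have Asym : A^T = A by rewrite /A !trmx_mul trmxK Msym mulmxA.
have A0 : delta_mx 0 0 *m A = a *: delta_mx 0 0 :> 'rV_(1 + n).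
  rewrite /A !mulmxA e0H uM -scalemxAl; congr (_ *: _).
  by rewrite -e0H -mulmxA HHT mulmx1.
have A0j j : A 0 j = a *+ (j == 0).
  have /rowP/(_ j) := A0; rewrite -rowE !mxE => ->.
  by rewrite eqxx mulr_natr.
have AH : A *m H = H *m M by rewrite /A -!mulmxA HTH mulmx1.
clearbody A; pose D := drsubmx A.
have l0 : lshift n (0 : 'I_1) = (0 : 'I_n.+1) by apply: val_inj.
have AE : A = block_mx a%:M 0 0 D.
  rewrite -[LHS]submxK; congr block_mx.
  - by apply/matrixP => i j; rewrite !ord1 !mxE l0 A0j.
  - by apply/matrixP => i j; rewrite !ord1 !mxE l0 A0j.
  - by apply/matrixP => i j; rewrite !ord1 !mxE -Asym mxE l0 A0j.
have Dsym : D^T = D.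
  by apply/matrixP => i j; rewrite !mxE -[in RHS]Asym mxE.
have [U' [d' [UU' UD' dec']]] := IHn D Dsym.
pose B : 'M[R]_(1 + n) := block_mx 1%:M 0 0 U'.
pose d : 'rV[R]_(1 + n) := row_mx a%:M d'.
have BBT : B *m B^T = 1%:M.
  rewrite /B tr_block_mx !trmx0 trmx1 mulmx_block !(mulmx0, mul0mx, mulmx1).
  by rewrite UU' !(addr0, add0r) -scalar_mx_block.
have BA : B *m A = diag_mx d *m B.
  rewrite AE /B /d diag_mx_row !mulmx_block !(mulmx0, mul0mx, mulmx1, mul1mx).
  rewrite !(addr0, add0r) UD'; congr block_mx.
  by apply/matrixP => i j; rewrite !ord1 !mxE /= !mulr1n.
have UUT : B *m H *m (B *m H)^T = 1%:M.
  by rewrite trmx_mul mulmxA -(mulmxA B) HHT mulmx1 BBT.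
have UM : B *m H *m M = diag_mx d *m (B *m H).
  by rewrite mulmxA -BA -!mulmxA AH.
exists (B *m H), d; split => //.
(* The rows of [B *m H] are unit eigenvectors, so the maximality of the form at [u] puts [a] in
   front of all other values. *)
have dle j : d 0 j <= a.
  have rowj : row j (B *m H) *m M = d 0 j *: row j (B *m H).
    by rewrite -row_mul UM row_mul row_diag_mx -scalemxAl -rowE.
  have r1 : mxform 1%:M (row j (B *m H)) (row j (B *m H)) = 1.
    rewrite /mxform mulmx1 tr_row -row_mul.
    have /matrixP/(_ j j) := UUT; rewrite !mxE eqxx => h; rewrite -[RHS]h.
    by apply: eq_bigr => k _; rewrite !mxE.
  have := umax (row j (B *m H)); rewrite r1 mulr1.
  rewrite {1}/mxform rowj -scalemxAl mxE.
  by have := r1; rewrite /mxform mulmx1 => ->; rewrite mulr1.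
move=> i j ij; have dE k :
    d 0 k = match fintype.split k with inl _ => a | inr k' => d' 0 k' end.
  by rewrite mxE; case: (fintype.split k) => // k0; rewrite ord1 mxE eqxx.
move: (dle j) ij; clearbody d; rewrite !dE.
case: fintype.splitP => [j0|j'] jE; case: fintype.splitP => [i0|i'] iE dj ij //.
- by move: ij; rewrite iE jE ord1.
- by apply: dec'; rewrite iE jE leq_add2l in ij.
Qed.

End symmetric_matrices.

(** * Diagonalisation of positive operators of finite rank *)

Section finite_rank.
Context {R : realType} {V : lmodType R}.

(** [K] is symmetric with range in the span of the [psi i], so its matrix there determines it; the
    rows of [U] combine the [psi i] into eigenvectors. *)
Lemma finite_rank_svd (A : ipSpace V) (K : V -> V) n (psi : 'I_n -> V) :
  inner_product A -> (forall x, carrier A x -> carrier A (K x)) ->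
  (forall a x y, carrier A x -> carrier A y -> K (a *: x + y) = a *: K x + K y) ->
  is_adjoint A A K K -> (forall x, carrier A x -> 0 <= dot A (K x) x) ->
  (forall i, carrier A (psi i)) ->
  (forall i j, dot A (psi i) (psi j) = (i == j)%:R) ->
  (forall x, carrier A x -> K x = \sum_i dot A (K x) (psi i) *: psi i) ->
  exists l e, is_svd A A K l e e.
Proof.
move=> hA KA Klin [_ Ksym] Kge0 Apsi psi1 Kpsi.
pose M : 'M[R]_n := \matrix_(i, j) dot A (K (psi i)) (psi j).
have Msym : M^T = M by apply/matrixP => i j; rewrite !mxE Ksym// (dotC hA).
have [U [d [UUT UM dec]]] := symmetric_spectral Msym.
have UTU : U^T *m U = 1%:M by apply: mulmx1C.
pose f i := \sum_j U i j *: psi j.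
have Af i : carrier A (f i).
  by apply: (carrier_sum hA) => j _; apply: (carrierZ hA).
have fpsi i k : dot A (f i) (psi k) = U i k.
  rewrite (dot_suml hA) (bigD1 k)//= big1 ?addr0 => [|j jk];
    by rewrite (dotZl hA) psi1 ?eqxx ?mulr1// (negbTE jk) mulr0.
have ff i k : dot A (f i) (f k) = (i == k)%:R.
  have /matrixP/(_ i k) := UUT; rewrite !mxE => <-.
  rewrite (dot_sumr hA); apply: eq_bigr => j _.
  by rewrite (dotZr hA) fpsi mxE mulrC.
have Kf i : K (f i) = d 0 i *: f i.
  rewrite (linear_sum hA Klin)// /f scaler_sumr.
  under eq_bigr do rewrite Kpsi// scaler_sumr.
  rewrite exchange_big/=; apply: eq_bigr => k _.
  under eq_bigr do rewrite scalerA.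
  rewrite -scaler_suml scalerA; congr (_ *: _).
  have /matrixP/(_ i k) := UM; rewrite mul_diag_mx !mxE => <-.
  by apply: eq_bigr => j _; rewrite !mxE.
have d0 i : 0 <= d 0 i.
  by have := Kge0 _ (Af i); rewrite Kf (dotZl hA) ff eqxx mulr1.
pose l k := if insub k is Some i then d 0 i else 0.
pose e k := if insub k is Some i then f i else 0.
have lo (i : 'I_n) : l i = d 0 i by rewrite /l valK.
have eo (i : 'I_n) : e i = f i by rewrite /e valK.
(* The padding by 0 keeps the list nonincreasing because positivity of [K] makes every [d 0 i]
   nonnegative. *)
have ln k : (n <= k)%N -> l k = 0 by move=> nk; rewrite /l insubF// ltnNge nk.
have he : orthonormal_family A [set k | l k != 0] e.
  split=> [k|i k]; rewrite /l /e /=; first by case: insubP; rewrite ?eqxx.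
  case: insubP => [i' _ <- _|]; last by rewrite eqxx.
  by case: insubP => [k' _ <- _|]; [rewrite ff | rewrite eqxx].
exists l, e; split.
- move=> i k ik; have [kn|nk] := ltnP k n.
    have iln := leq_ltn_trans ik kn.
    by rewrite (lo (Ordinal kn)) (lo (Ordinal iln)) dec.
  by rewrite (ln k nk) /l; case: insubP => *; rewrite ?d0.
- by apply: (@cvg_eventually_cst _ _ n) => k /ln.
- exact: he.
- exact: he.
- move=> x Ax; apply: (@cvg_eventually_cst _ _ n) => k nk.
  suff -> : \sum_(j < k | (j : nat) \in setT) l j *: (dot A (e j) x *: e j) = K x.
    by rewrite subrr (ipnorm0 hA).
  rewrite (eq_bigl xpredT) => [|j]; last by rewrite in_setT.
  rewrite -(big_mkord xpredT (fun j => l j *: (dot A (e j) x *: e j))).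
  rewrite (big_cat_nat (n := n))//= [X in _ + X]big_nat_cond [X in _ + X]big1.
    rewrite addr0 big_mkord.
    transitivity (\sum_i dot A (K x) (f i) *: f i).
      apply: eq_bigr => i _; rewrite lo eo Ksym// Kf (dotZr hA) scalerA.
      by rewrite (dotC hA x).
    rewrite {2}Kpsi// /f.
    under eq_bigr do rewrite scaler_sumr.
    rewrite exchange_big/=; apply: eq_bigr => k' _.
    under eq_bigr do rewrite scalerA.
    rewrite -scaler_suml; congr (_ *: _).
    (* The return from the [f i] to the [psi i] rests on [U^T *m U = 1%:M]. *)
    transitivity (\sum_i \sum_j dot A (K x) (psi j) * (U i j * U i k')).
      apply: eq_bigr => i _; rewrite (dot_sumr hA) mulr_suml.
      by apply: eq_bigr => j _; rewrite (dotZr hA) mulrCA mulrA.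
    rewrite exchange_big/= (bigD1 k')//= [X in _ + X]big1 ?addr0 => [|j jk].
      rewrite -mulr_sumr; have /matrixP/(_ k' k') := UTU.
      rewrite !mxE eqxx => h; rewrite -[RHS]mulr1; congr (_ * _); rewrite -[RHS]h.
      by apply: eq_bigr => i _; rewrite !mxE.
    rewrite -mulr_sumr; have /matrixP/(_ j k') := UTU.
    rewrite !mxE (negbTE jk) => h; rewrite -[RHS](mulr0 (dot A (K x) (psi j))).
    congr (_ * _); rewrite -[RHS]h.
    by apply: eq_bigr => i _; rewrite !mxE.
  by move=> j /andP[/andP[/ln ->]]; rewrite scale0r.
Qed.

End finite_rank.

(** * Operators that are diagonal in an orthonormal basis *)

Section diagonal_operators.
Context {R : realType} {V : lmodType R}.
Variables (A : ipSpace V) (hA : inner_product A) (J : set nat) (phi : nat -> V).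
Hypothesis phi_basis : orthonormal_basis A J phi.

(** Stated through coordinates, so that no convergence has to be mentioned; by [basis_eq] the
    multiplier determines [D] on the carrier. *)
Definition diagonal_operator (d : nat -> R) (D : V -> V) : Prop :=
  (forall x, carrier A x -> carrier A (D x)) /\
  forall x j, carrier A x -> J j -> dot A (D x) (phi j) = d j * dot A x (phi j).

Lemma diagonal_comp d1 d2 D1 D2 : diagonal_operator d1 D1 -> diagonal_operator d2 D2 ->
  diagonal_operator (fun j => d1 j * d2 j) (D1 \o D2).
Proof.
move=> [A1 h1] [A2 h2]; split=> [x Ax|x j Ax Jj]; first exact/A1/A2.
by rewrite /= h1 ?h2 ?mulrA//; exact: A2.
Qed.

Lemma diagonal_eq d D1 D2 x : diagonal_operator d D1 -> diagonal_operator d D2 ->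
  carrier A x -> D1 x = D2 x.
Proof.
move=> [A1 h1] [A2 h2] Ax; apply: (basis_eq hA phi_basis); [exact: A1|exact: A2|].
by move=> j Jj; rewrite h1// h2.
Qed.

Lemma eq_diagonal d1 d2 D : (forall j, J j -> d1 j = d2 j) -> diagonal_operator d1 D ->
  diagonal_operator d2 D.
Proof. by move=> h [A1 h1]; split=> // x j Ax Jj; rewrite h1// h. Qed.

Lemma diagonal_ext d D1 D2 : (forall x, carrier A x -> D1 x = D2 x) ->
  diagonal_operator d D1 -> diagonal_operator d D2.
Proof.
move=> h [A1 h1]; split=> [x Ax|x j Ax Jj]; first by rewrite -h//; exact: A1.
by rewrite -h// h1.
Qed.

Section one_operator.
Variables (d : nat -> R) (D : V -> V) (hD : diagonal_operator d D).

Lemma diagonal_lin a x y : carrier A x -> carrier A y ->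
  D (a *: x + y) = a *: D x + D y.
Proof.
case: hD => AD h Ax Ay; have Axy := carrier_lin hA a Ax Ay.
apply: (basis_eq hA phi_basis) => [||j Jj]; first exact: AD.
  by apply: (carrier_lin hA); exact: AD.
by rewrite h// !(dotDl hA, dotZl hA) !h//; ring.
Qed.

Lemma diagonal_adjoint : is_adjoint A A D D.
Proof.
case: hD => AD h; split=> // x y Ax Ay.
apply: (cvg_unique _ (parseval hA phi_basis (y := y) (AD x Ax))) => //.
have := parseval hA phi_basis (y := D y) Ax.
apply: cvg_trans; apply: near_eq_cvg; apply: nearW => n /=.
by apply: eq_bigr => j /set_mem Jj; rewrite !h//; ring.
Qed.

Lemma diagonal_norm M x : 0 <= M -> (forall j, J j -> `|d j| <= M) -> carrier A x ->
  ipnorm A (D x) <= M * ipnorm A x.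
Proof.
case: hD => AD h M0 dM Ax.
rewrite -(@ler_pXn2r _ 2)// ?nnegrE ?mulr_ge0 ?ipnorm_ge0//.
rewrite exprMn !(ipnorm_sqr hA).
apply: (cvg_leP (parseval hA phi_basis (y := D x) (AD x Ax))) => n.
apply: le_trans (ler_wpM2l (sqr_ge0 M) (bessel hA phi_basis.1 x n)).
rewrite mulr_sumr; apply: ler_sum => j /set_mem Jj.
rewrite h// -expr2 exprMn ler_wpM2r ?sqr_ge0//.
by rewrite -[leLHS]real_normK ?num_real// lerXn2r ?nnegrE ?dM.
Qed.

Lemma diagonal_bounded M : (forall j, J j -> `|d j| <= M) -> bounded_operator A A D.
Proof.
move=> dM; split; [exact: hD.1 | exact: diagonal_lin | exists (Num.max M 0)].
move=> x Ax; apply: diagonal_norm => // [|j Jj]; first by rewrite le_max lexx orbT.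
by rewrite le_max dM.
Qed.

Lemma diagonal_ge0 x : (forall j, J j -> 0 <= d j) -> carrier A x ->
  0 <= dot A (D x) x.
Proof.
case: hD => AD h d0 Ax; rewrite -oppr_le0.
apply: (cvg_leP (cvgN (parseval hA phi_basis (y := x) (AD x Ax)))) => n.
rewrite oppr_le0 sumr_ge0// => j /set_mem Jj.
by rewrite h// -mulrA mulr_ge0 ?d0// -expr2 sqr_ge0.
Qed.

Lemma diagonal_positive M : (forall j, J j -> 0 <= d j <= M) -> positive_operator A D.
Proof.
move=> dM; split; [|exact: diagonal_adjoint|].
  by apply: (@diagonal_bounded M) => j /dM /andP[d0 ?]; rewrite ger0_norm.
by move=> x; apply: diagonal_ge0 => j /dM /andP[].
Qed.

(* If [B] is a positive square root of [D \o D], then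
   [y = B phi_j - d_j phi_j] satisfies [B y = - d_j y], whence [y = 0]. *)
Lemma op_sqrt_diagonal T M : (forall j, J j -> 0 <= d j <= M) ->
  (forall x, carrier A x -> T x = D (D x)) -> diagonal_operator d (op_sqrt A T).
Proof.
move=> dM TD.
have hB : (fun B => positive_operator A B /\
    forall x, carrier A x -> B (B x) = T x) (op_sqrt A T).
  apply: (@xgetPex _ _ [set B | positive_operator A B /\
    forall x, carrier A x -> B (B x) = T x]).
  by exists D; split=> [|x Ax]; [exact: diagonal_positive dM | rewrite TD].
move: (op_sqrt A T) hB => B [[[BA Blin _] [_ Bsym] Bge0] BB].
split=> // x j Ax Jj; have Aj := phi_basis.1.1 j Jj; have [AD hDd] := hD.
have /andP[dj0 _] := dM j Jj.
have Dphi : D (phi j) = d j *: phi j.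
  apply: (basis_eq hA phi_basis) => [||k Jk]; [exact: AD|exact: (carrierZ hA)|].
  rewrite hDd// (dotZl hA) phi_basis.1.2//.
  by case: eqP => [->|_]; rewrite ?mulr0.
have BBphi : B (B (phi j)) = (d j ^+ 2) *: phi j.
  rewrite BB// TD// Dphi -[d j *: phi j]addr0 diagonal_lin//; last exact: (carrier0 hA).
  have D0 : D 0 = 0.
    have := diagonal_lin (-1) (carrier0 hA) (carrier0 hA).
    by rewrite !scaleN1r addr0 oppr0 addNr.
  by rewrite D0 addr0 Dphi scalerA expr2.
pose y := B (phi j) - d j *: phi j.
have Ay : carrier A y by apply: (carrierB hA); [exact: BA|exact: (carrierZ hA)].
have By : B y = - d j *: y.
  rewrite /y addrC -scaleNr Blin//; last exact: BA.
  by rewrite BBphi scalerDr scalerA mulNr mulrN opprK -expr2 addrC.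
have y0 : y = 0.
  apply: (ip_def hA); apply/eqP; rewrite eq_le (form_ge0 (ip_form hA)) andbT.
  have := Bge0 y Ay; rewrite By (dotZl hA) mulNr oppr_ge0.
  (* For d_j > 0, positivity of [B] gives - d_j <y, y> >= 0. For d_j = 0 it says nothing, but then y
     = B phi_j and <y, y> = <phi_j, B B phi_j> = 0. *)
  have [d0|d0] := eqVneq (d j) 0; last by rewrite pmulr_rle0// lt_def d0.
  move=> _; rewrite /y d0 scale0r subr0.
  by rewrite Bsym ?BBphi ?d0 ?expr0n ?scale0r ?(dot0r hA)//; exact: BA.
have Bphi : B (phi j) = d j *: phi j by apply/eqP; rewrite -subr_eq0 -/y y0.
by rewrite Bsym// Bphi (dotZr hA).
Qed.

End one_operator.

(** Symmetry of the products yields T G1 = T G2 and G1 T = G2 T on the carrier; then G1 = G1 T G1 =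
    G1 T G2 = G2 T G2 = G2. *)
Lemma mp_inverse_unique T G1 G2 y :
  is_mp_inverse A A T G1 -> is_mp_inverse A A T G2 ->
  (forall x, carrier A x -> carrier A (T x)) -> carrier A y -> G1 y = G2 y.
Proof.
move=> [[A1 _ _] t1 g1 [_ s1] [_ r1]] [[A2 _ _] t2 g2 [_ s2] [_ r2]] TA Ay.
have TG x : carrier A x -> T (G1 x) = T (G2 x).
  move=> Ax; apply: (ip_eq hA) => [||z Az]; [exact/TA/A1|exact/TA/A2|].
  have -> : T (G1 x) = T (G2 (T (G1 x))) by rewrite t2//; exact: A1.
  have s1' u v : carrier A u -> carrier A v ->
    dot A (T (G1 u)) v = dot A u (T (G1 v)) := s1 u v.
  have s2' u v : carrier A u -> carrier A v ->
    dot A (T (G2 u)) v = dot A u (T (G2 v)) := s2 u v.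
  by rewrite s2' ?s1' ?t1 -?s2'//; do ?[exact: A1|exact: A2|apply: TA].
have GT x : carrier A x -> G1 (T x) = G2 (T x).
  move=> Ax; apply: (ip_eq hA) => [||z Az]; [exact/A1/TA|exact/A2/TA|].
  have r1' u v : carrier A u -> carrier A v ->
    dot A (G1 (T u)) v = dot A u (G1 (T v)) := r1 u v.
  have r2' u v : carrier A u -> carrier A v ->
    dot A (G2 (T u)) v = dot A u (G2 (T v)) := r2 u v.
  rewrite r1'// -[T z]t2//.
  have AGTz : carrier A (G2 (T z)) by exact/A2/TA.
  by rewrite -r1'// -r2' ?t1//; exact/A1/TA.
by rewrite -g1// TG// GT ?g2//; exact: A2.
Qed.

(** As 0^-1 = 0, the number (d j)^-1 is already the pseudo-inverse of d j, and the Penrose equations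
    hold coordinate by coordinate. *)
Lemma mp_inverse_diagonal T D E d M : diagonal_operator d D ->
  diagonal_operator (fun j => (d j)^-1) E ->
  (forall j, J j -> `|(d j)^-1| <= M) ->
  (forall x, carrier A x -> T x = D x) ->
  diagonal_operator (fun j => (d j)^-1) (mp_inverse A A T).
Proof.
move=> hD hE dM TD; have [AD _] := hD; have [AE _] := hE.
have hT : diagonal_operator d T by apply: diagonal_ext hD => x Ax; rewrite TD.
have [AT _] := hT.
have hEmp : is_mp_inverse A A T E.
  split.
  - exact: diagonal_bounded hE M dM.
  - move=> x Ax; apply: (diagonal_eq (D1 := T \o (E \o T)) _ hT Ax).
    apply: eq_diagonal (diagonal_comp hT (diagonal_comp hE hT)) => j Jj.
    by have [->|d0] := eqVneq (d j) 0; rewrite ?mul0r// mulVf ?mulr1.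
  - move=> x Ax; apply: (diagonal_eq (D1 := E \o (T \o E)) _ hE Ax).
    apply: eq_diagonal (diagonal_comp hE (diagonal_comp hT hE)) => j Jj.
    by have [->|d0] := eqVneq (d j) 0; rewrite ?invr0 ?mul0r// mulfV ?mulr1.
  - exact: diagonal_adjoint (diagonal_comp hT hE).
  - exact: diagonal_adjoint (diagonal_comp hE hT).
apply: diagonal_ext hE => x Ax; apply: (mp_inverse_unique (T := T)) => //.
by apply: (@xgetPex _ _ [set G | is_mp_inverse A A T G]); exists E.
Qed.

Lemma diagonal_exists d N : (forall j, J j -> d j != 0 -> (j < N)%N) ->
  exists D, diagonal_operator d D /\
    forall x, D x = \sum_(j < N | (j : nat) \in J) (d j * dot A x (phi j)) *: phi j.
Proof.
move=> dN; eexists; split; last by [].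
split=> [x Ax|x j Ax Jj].
  apply: (carrier_sum hA) => j /set_mem Jj; apply: (carrierZ hA).
  exact: phi_basis.1.1.
rewrite (dot_orthonormal_sum hA phi_basis.1 (fun j => d j * dot A x (phi j)))//.
case: ifPn => // jN; have [->|d0] := eqVneq (d j) 0; first by rewrite mul0r.
by rewrite dN in jN.
Qed.

Lemma finite_support_bounded (d : nat -> R) N :
  (forall j, J j -> d j != 0 -> (j < N)%N) -> exists M, forall j, J j -> `|d j| <= M.
Proof.
move=> dN; exists (\sum_(j < N) `|d j|) => j Jj.
have [->|d0] := eqVneq (d j) 0; first by rewrite normr0 sumr_ge0.
by rewrite (bigD1 (Ordinal (dN j Jj d0)))//= lerDl sumr_ge0.
Qed.

(** 1 - Pi m is a contraction that kills the n-th partial sum [s n] of [x] once p m j = 1 for all j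
    < n in [J]; hence |Pi m x - x| <= |s n - x|. *)
Lemma diagonal_cvg (p : nat -> nat -> R) (Pi : nat -> V -> V) x :
  (forall m, diagonal_operator (p m) (Pi m)) -> (forall m j, 0 <= p m j <= 1) ->
  (forall j, J j -> exists m0, forall m, (m0 <= m)%N -> p m j = 1) ->
  carrier A x -> tends A (fun m => Pi m x) x.
Proof.
move=> hPi p01 p1 Ax; apply/cvgrPdist_le => eps eps0.
pose s n := \sum_(j < n | (j : nat) \in J) dot A x (phi j) *: phi j.
have As n : carrier A (s n).
  apply: (carrier_sum hA) => j /set_mem Jj; apply: (carrierZ hA).
  exact: phi_basis.1.1.
have /cvgrPdist_le/(_ eps eps0)[n _ /(_ n (leqnn n))] := phi_basis.2 x Ax.
rewrite /= sub0r normrN ger0_norm ?ipnorm_ge0// -/(s n) => sn.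
have [m0 hm0] : exists m0, forall m j, (m0 <= m)%N -> J j -> (j < n)%N -> p m j = 1.
  elim: n {sn} => [|n [m1 IH]]; first by exists 0%N.
  have [Jn|Jn] := pselect (J n); last first.
    exists m1 => m j mm Jj; rewrite ltnS leq_eqVlt => /orP[/eqP jn|]; last exact: IH.
    by rewrite jn in Jj.
  have [m2 h2] := p1 n Jn; exists (maxn m1 m2) => m j; rewrite geq_max => /andP[h1m h2m].
  by move=> Jj; rewrite ltnS leq_eqVlt => /orP[/eqP->|]; [exact: h2|exact: IH].
exists m0 => // m /= mm; rewrite sub0r normrN ger0_norm ?ipnorm_ge0//.
have [AP hP] := hPi m.
pose Q x := x - Pi m x.
have hQ : diagonal_operator (fun j => 1 - p m j) Q.
  split=> [z Az|z j Az Jj]; first by apply: (carrierB hA) => //; exact: AP.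
  by rewrite (dotBl hA) hP//; ring.
have Qs : Q (s n) = 0.
  apply: (basis_eq hA phi_basis) => [||j Jj]; [exact: hQ.1|exact: (carrier0 hA)|].
  rewrite hQ.2// (dot0l hA).
  rewrite (dot_orthonormal_sum hA phi_basis.1 (fun j => dot A x (phi j)))//.
  by case: ifPn => [jn|_]; rewrite ?mulr0// hm0// subrr mul0r.
have -> : Pi m x - x = Q (s n - x).
  have -> : s n - x = -1 *: x + s n by rewrite addrC scaleN1r.
  by rewrite (diagonal_lin hQ)// Qs addr0 /Q scaleN1r opprB.
apply: le_trans sn; rewrite -[leRHS]mul1r; apply: (diagonal_norm hQ) => //.
  by move=> j _; have /andP[] := p01 m j; rewrite ler_norml; lra.
exact: (carrierB hA).
Qed.

End diagonal_operators.

(** * Eigenprojections and truncations in an eigenbasis *)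

Section truncations.
Context {R : realType} {V : lmodType R}.
Variables (A : ipSpace V) (hA : inner_product A) (T : V -> V).
Variables (J : set nat) (phi : nat -> V) (lam : nat -> R).
Hypothesis T_basis : eigenbasis A T J phi lam.
Hypothesis T_diagonal : diagonal_operator A J phi lam T.
Hypothesis lam_finite : forall c, 0 < c ->
  exists N, forall j, J j -> c <= lam j -> (j < N)%N.

Let phi_basis : orthonormal_basis A J phi. Proof. by case: T_basis. Qed.
Let lam_gt0 j : J j -> 0 < lam j. Proof. by case: T_basis => _ _ _ _; apply. Qed.
Local Notation nth h mu := (nth_distinct_eigenvalue A T h mu).

Lemma eigenvalue_basis mu : Defs.eigenvalue A T mu <-> exists2 j, J j & lam j = mu.
Proof.
split=> [[x [Ax Tx] x0]|[j Jj <-]].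
  apply: contrapT => h; move/eqP: x0; apply.
  apply: (basis_eq hA phi_basis) => [//||j Jj]; first exact: (carrier0 hA).
  rewrite (dot0l hA); have := T_diagonal.2 x j Ax Jj; rewrite Tx (dotZl hA) => /eqP.
  rewrite -subr_eq0 -mulrBl mulf_eq0 subr_eq0 => /orP[/eqP mul|/eqP//].
  by case: h; exists j.
exists (phi j); first by split; [exact: phi_basis.1.1 | case: T_basis => _ _ -> //].
apply/eqP => p0; have := phi_basis.1.2 j j Jj Jj.
by rewrite p0 (dot0l hA) eqxx => /esym/eqP; rewrite oner_eq0.
Qed.

Lemma nth_eigenvalue_inj h h' mu : nth h mu -> nth h' mu -> h = h'.
Proof.
move=> [_ c1] [_ c2]; apply/card_eq_II; apply: card_eq_trans c2.
by rewrite card_eq_sym.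
Qed.

(** If mu < mu', the eigenvalues above mu include mu' and all those above mu'; two finite sets of
    the same size cannot be so nested. *)
Lemma nth_eigenvalue_unique h mu mu' : nth h mu -> nth h mu' -> mu = mu'.
Proof.
wlog lt : mu mu' / mu < mu' => [W|] h1 h2.
  have [lt|lt|//] := ltgtP mu mu'; first exact: W.
  by apply/esym/W.
case: h1 h2 => e1 c1 [e2 c2].
set B1 := [set nu | _ /\ mu < nu] in c1; set B2 := [set nu | _ /\ mu' < nu] in c2.
have f1 : finite_set B1 by apply/finite_setP; exists h.
have f2 : finite_set B2 by apply/finite_setP; exists h.
have B21 : B2 `<=` B1 by move=> nu [? mu'nu]; split=> //; exact: lt_trans mu'nu.
have eqB : (#|` fset_set B1| = #|` fset_set B2|)%fset.
  by apply/fcard_eq => //; apply: card_eq_trans c1 _; rewrite card_eq_sym.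
have : fset_set B2 == fset_set B1.
  by rewrite eqEfcard eqB leqnn andbT -fset_set_sub.
move=> /eqP/fset_set_inj => /(_ f2 f1) eq21.
have : B1 mu' by split.
by rewrite -eq21 => -[_]; rewrite ltxx.
Qed.

Lemma nth_eigenvalue_exists j : J j -> exists h, nth h (lam j).
Proof.
move=> Jj; suff /finite_setP[h hh] :
    finite_set [set nu | Defs.eigenvalue A T nu /\ lam j < nu].
  by exists h; split=> //; apply/eigenvalue_basis; exists j.
apply: (@sub_finite_set _ _ (lam @` `I_j)); last exact/finite_image/finite_II.
move=> nu [/eigenvalue_basis[i Ji <-] ji]; exists i => //=.
rewrite ltnNge; apply/negP => ij; case: T_basis => _ _ _ dec _.
by have := dec _ _ ij Ji; rewrite leNgt ji.
Qed.

(** The coordinates kept by the projection on the eigenspaces of the [m] largest distinct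
    eigenvalues. *)
Definition leading m j : bool := `[< exists2 h, (h < m)%N & nth h (lam j) >].

Lemma leadingS m n j : (m <= n)%N -> leading m j -> leading n j.
Proof.
move=> mn /asboolP[h hm hh]; apply/asboolP; exists h => //.
exact: leq_trans hm mn.
Qed.

Lemma leading_eventually j : J j ->
  exists m0, forall m, (m0 <= m)%N -> leading m j.
Proof.
move=> /nth_eigenvalue_exists[h hh]; exists h.+1 => m hm.
by apply/asboolP; exists h.
Qed.

(** Finite multiplicity: [lam_finite] is used with [c] the eigenvalue itself. *)
Lemma nth_eigenvalue_support h : exists N, forall j, J j -> nth h (lam j) -> (j < N)%N.
Proof.
have [[j0 Jj0 h0]|no] := pselect (exists2 j0, J j0 & nth h (lam j0)); last first.
  by exists 0%N => j Jj hj; case: no; exists j.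
have [N hN] := lam_finite (lam_gt0 Jj0); exists N => j Jj hj.
by apply: hN => //; rewrite (nth_eigenvalue_unique h0 hj).
Qed.

Lemma leading_support m : exists N, forall j, J j -> leading m j -> (j < N)%N.
Proof.
elim: m => [|m [N hN]]; first by exists 0%N => j _ /asboolP[].
have [N' hN'] := nth_eigenvalue_support m.
exists (maxn N N') => j Jj /asboolP[h]; rewrite ltnS leq_eqVlt leq_max.
move=> /orP[/eqP->|hm] hh; first by rewrite (hN' j)// orbT.
by rewrite (hN j)//; apply/asboolP; exists h.
Qed.

(** Finite multiplicity provides the 0-1 multiplier as a finite sum. It satisfies the conditions of
    an orthogonal projection, and two candidates differ by a vector orthogonal to itself. *)
Lemma eigenprojection_diagonal h :
  diagonal_operator A J phi (fun j => `[< nth h (lam j) >]%:R) (eigenprojection A T h).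
Proof.
have [N hN] := nth_eigenvalue_support h.
set d := fun j : nat => _.
have [|D [hD _]] := @diagonal_exists _ _ _ hA _ _ phi_basis d N.
  move=> j Jj; rewrite /d; case: asboolP => [hj _|]; first exact: hN.
  by rewrite eqxx.
apply: (diagonal_ext _ hD) => x Ax; apply/esym; apply: xget_subset1; last first.
  move=> p q [Ep xp] [Eq xq]; apply/esym/eqP; rewrite -subr_eq0; apply/eqP.
  apply: (ip_def hA).
  have qpE : q - p = (x - p) - (x - q) by rewrite opprB [RHS]addrC subrKA.
  by rewrite {1}qpE (dotBl hA) !(dotBr hA) !(xp, xq)// !subrr.
split.
- have [[j0 Jj0 h0]|no] := pselect (exists2 j0, J j0 & nth h (lam j0)).
    right; exists (lam j0) => //; split; first exact: hD.1.
    apply: (basis_eq hA phi_basis) => [||j Jj].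
    + exact/T_diagonal.1/hD.1.
    + exact/(carrierZ hA)/hD.1.
    rewrite T_diagonal.2//; last exact: hD.1.
    rewrite (dotZl hA) hD.2// /d; case: asboolP => [hj|]; last by rewrite mul0r !mulr0.
    by rewrite (nth_eigenvalue_unique h0 hj).
  left; apply: (basis_eq hA phi_basis) => [||j Jj]; [exact: hD.1|exact: (carrier0 hA)|].
  rewrite hD.2// (dot0l hA) /d; case: asboolP => [hj|]; last by rewrite mul0r.
  by case: no; exists j.
- move=> q [->|[mu hmu [Aq Tq]]]; first by rewrite (dot0r hA).
  have Dq : D q = q.
    apply: (basis_eq hA phi_basis) => [||j Jj]; [exact: hD.1|by []|].
    rewrite hD.2//; have := T_diagonal.2 q j Aq Jj; rewrite Tq (dotZl hA) => /eqP.
    rewrite -subr_eq0 -mulrBl mulf_eq0 subr_eq0 => /orP[/eqP mul|/eqP->];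
      last by rewrite mulr0.
    by rewrite /d -mul; case: asboolP => // _; rewrite mul1r.
  have [_ Dadj] := diagonal_adjoint hA phi_basis hD.
  by rewrite (dotBl hA) Dadj// Dq subrr.
Qed.

Definition leading_projection m (x : V) : V := \sum_(h < m) eigenprojection A T h x.

(** An eigenvalue has a single rank, so each coordinate is kept by at most one summand and the
    indicators add up to an indicator. *)
Lemma leading_projection_diagonal m :
  diagonal_operator A J phi (fun j => (leading m j)%:R) (leading_projection m).
Proof.
elim: m => [|m IH].
  split=> [x Ax|x j Ax Jj]; rewrite /leading_projection big_ord0.
    exact: (carrier0 hA).
  rewrite (dot0l hA) /leading; case: asboolP => [[]//|_]; by rewrite mul0r.
have [AE hE] := eigenprojection_diagonal m; have [AP hP] := IH.
split=> [x Ax|x j Ax Jj]; rewrite /leading_projection big_ord_recr/=.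
  by apply: (carrierD hA); [exact: AP|exact: AE].
rewrite (dotDl hA) hE// [dot A _ _](hP x j)// -mulrDl; congr (_ * _).
rewrite -natrD; congr (_%:R); rewrite /leading.
case: asboolP => [[h hm hh]|h1]; case: asboolP => h2.
- by have := nth_eigenvalue_inj hh h2 => hm'; rewrite hm' ltnn in hm.
- by rewrite (_ : asbool _)//; apply/asboolP; exists h => //; rewrite ltnS ltnW.
- by rewrite (_ : asbool _)//; apply/asboolP; exists m.
- case: asboolP => // -[h]; rewrite ltnS leq_eqVlt => /orP[/eqP->//|hm hh].
  by case: h1; exists h.
Qed.

(** The truncation has multiplier d^2 for d_j = sqrt(lam_j) on the leading indices and 0 elsewhere.
    Only finitely many d_j are nonzero, so the pseudo-inverse is bounded. *)
Lemma truncation_root_mp_inverse m :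
  diagonal_operator A J phi (fun j => (Num.sqrt (lam j) * (leading m j)%:R)^-1)
    (mp_inverse A A (op_sqrt A (truncation A T m))).
Proof.
have [N hN] := leading_support m.
set d := fun j => Num.sqrt (lam j) * (leading m j)%:R.
have dN j : J j -> d j != 0 -> (j < N)%N.
  move=> Jj; rewrite /d; case: (boolP (leading m j)) => [hj _|]; first exact: hN.
  by rewrite mulr0 eqxx.
have dN' j : J j -> (d j)^-1 != 0 -> (j < N)%N by rewrite invr_eq0; exact: dN.
have [D [hD _]] := diagonal_exists hA phi_basis dN.
have [E [hE _]] := diagonal_exists hA phi_basis dN'.
have [M hM] := finite_support_bounded dN.
have [M' hM'] := finite_support_bounded dN'.
have hS : diagonal_operator A J phi d (op_sqrt A (truncation A T m)).
  apply: (@op_sqrt_diagonal _ _ _ hA _ _ phi_basis d D hD _ M).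
    move=> j Jj; have := hM j Jj; rewrite ger0_norm.
      by move=> ->; rewrite mulr_ge0 ?sqrtr_ge0// ler0n.
    by rewrite mulr_ge0 ?sqrtr_ge0// ler0n.
  move=> x Ax; apply: (diagonal_eq hA phi_basis _ (diagonal_comp hD hD) Ax).
  apply: eq_diagonal (diagonal_comp T_diagonal (leading_projection_diagonal m)).
  move=> j Jj; rewrite /d mulrACA -expr2 sqr_sqrtr ?ltW ?lam_gt0//.
  by case: leading; rewrite ?mulr1 ?mulr0.
apply: (@mp_inverse_diagonal _ _ _ hA _ _ phi_basis _ D E d M') => // x Ax.
exact: (diagonal_eq hA phi_basis hS hD Ax).
Qed.

End truncations.

(** * Isometries and the reproducing kernel Hilbert spaces *)

Section unitary.
Context {R : realType} {V : lmodType R}.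
Implicit Types (A B : ipSpace V) (U W K T : V -> V).

Definition subspace (D : set V) : Prop :=
  D 0 /\ forall a x y, D x -> D y -> D (a *: x + y).

(** All conditions concern carriers only, because the inner product of a reproducing kernel space is
    a limit that is under control only there. *)
Record isometry A B U : Prop := Isometry {
  isometry_dom : subspace (carrier A) ;
  isometry_carrier : forall x, carrier A x -> carrier B (U x) ;
  isometry_lin : forall a x y, carrier A x -> carrier A y ->
    U (a *: x + y) = a *: U x + U y ;
  isometry_dot : forall x y, carrier A x -> carrier A y ->
    dot B (U x) (U y) = dot A x y }.

Section one_isometry.
Variables (A B : ipSpace V) (U : V -> V) (hU : isometry A B U).

Lemma isometry0 : U 0 = 0.
Proof.
have [A0 _] := isometry_dom hU.
by have := isometry_lin hU (-1) A0 A0; rewrite !scaleN1r addr0 oppr0 addNr.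
Qed.

Lemma isometryZ a x : carrier A x -> U (a *: x) = a *: U x.
Proof.
have [A0 _] := isometry_dom hU => Ax.
by have := isometry_lin hU a Ax A0; rewrite isometry0 !addr0.
Qed.

Lemma isometryD x y : carrier A x -> carrier A y -> U (x + y) = U x + U y.
Proof.
by move=> Ax Ay; have := isometry_lin hU 1 Ax Ay; rewrite !scale1r.
Qed.

Lemma isometry_domZ a x : carrier A x -> carrier A (a *: x).
Proof.
have [A0 Alin] := isometry_dom hU => Ax; rewrite -[a *: x]addr0; exact: Alin.
Qed.

Lemma isometry_sum n (p : pred nat) (u : nat -> V) :
  (forall k, p k -> carrier A (u k)) ->
  carrier A (\sum_(k < n | p k) u k) /\
  U (\sum_(k < n | p k) u k) = \sum_(k < n | p k) U (u k).
Proof.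
have [A0 Alin] := isometry_dom hU => Au.
apply: (big_rec2 (fun x y => carrier A x /\ U x = y)) => [|i y x pi [Ax <-]].
  by split=> //; exact: isometry0.
split; last by rewrite isometryD//; exact: Au.
by rewrite -[u i]scale1r; apply: Alin => //; exact: Au.
Qed.

Lemma isometry_tends u x : (forall n, carrier A (u n)) -> carrier A x ->
  tends A u x -> tends B (U \o u) (U x).
Proof.
have [A0 Alin] := isometry_dom hU => Au Ax.
apply: cvg_trans; apply: near_eq_cvg; apply: nearW => n /=.
have Aux : carrier A (u n - x) by rewrite addrC -scaleN1r; apply: Alin.
have -> : U (u n) - U x = U (u n - x).
  by rewrite addrC -scaleN1r -(isometry_lin hU)// scaleN1r addrC.
by rewrite /ipnorm (isometry_dot hU).
Qed.

Lemma isometry_orthonormal J e : orthonormal_family A J e ->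
  orthonormal_family B J (U \o e).
Proof.
move=> [Ae ee]; split=> [j Jj|j k Jj Jk]; first exact/(isometry_carrier hU)/Ae.
by rewrite /= (isometry_dot hU) ?ee//; exact: Ae.
Qed.

End one_isometry.

Lemma isometry_svd A A' B B' U U' T T' rho g f :
  isometry A B U -> isometry A' B' U' ->
  (forall y, carrier B y -> exists2 x, carrier A x & y = U x) ->
  (forall x, carrier A x -> carrier A' (T x)) ->
  (forall x, carrier A x -> T' (U x) = U' (T x)) ->
  is_svd A A' T rho g f -> is_svd B B' T' rho (U \o g) (U' \o f).
Proof.
move=> hU hU' onto AT TT' [dec lim hg hf hs]; split=> //.
- exact: (isometry_orthonormal hU hg).
- exact: (isometry_orthonormal hU' hf).
move=> _ /onto[x Ax ->]; rewrite TT'//.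
pose u k := rho k *: (dot A (g k) x *: f k).
have Au k : carrier A' (u k).
  rewrite /u; have [->|k0] := eqVneq (rho k) 0.
    by rewrite scale0r; case: (isometry_dom hU').
  by do 2 apply: (isometry_domZ hU'); exact: hf.1.
have := isometry_tends hU' (fun n => (isometry_sum hU' n
  (p := fun k => k \in setT) (fun k _ => Au k)).1) (AT x Ax) (hs x Ax).
rewrite /sums_to; congr tends; apply/funext => n /=.
rewrite (isometry_sum hU' n (p := fun k => k \in setT) (fun k _ => Au k)).2.
apply: eq_bigr => k _; rewrite /u; have [->|k0] := eqVneq (rho k) 0.
  by rewrite !scale0r (isometry0 hU').
have Af : carrier A' (f k) by exact: hf.1.
have Ag : carrier A (g k) by exact: hg.1.
rewrite (isometryZ hU'); last exact: (isometry_domZ hU').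
by rewrite (isometryZ hU')//= (isometry_dot hU).
Qed.

Lemma isometry_eigenvalue_list A B U W K K' l :
  isometry A B U -> isometry B A W ->
  (forall x, carrier A x -> W (U x) = x) -> (forall y, carrier B y -> U (W y) = y) ->
  (forall x, carrier A x -> K' (U x) = U (K x)) ->
  (forall x, carrier A x -> carrier A (K x)) ->
  is_eigenvalue_list A K l -> is_eigenvalue_list B K' l.
Proof.
move=> hU hW WU UW KK' AK [dec l0 hl]; split=> // mu mu0.
have [e [[Ee ee] eb]] := hl mu mu0.
have EU x : Defs.eigenspace A K mu x -> Defs.eigenspace B K' mu (U x).
  move=> [Ax Kx]; split; first exact: (isometry_carrier hU).
  by rewrite KK'// Kx (isometryZ hU).
have EW y : Defs.eigenspace B K' mu y -> Defs.eigenspace A K mu (W y).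
  move=> [By Ky]; have AW := isometry_carrier hW By; split => //.
  by rewrite -[LHS](WU _ (AK _ AW)) -KK'// UW// Ky (isometryZ hW).
exists (U \o e); split; first split=> [j lj|j k lj lk].
- exact/EU/Ee.
- by rewrite /= (isometry_dot hU); [exact: ee|exact: (Ee _ _).1|exact: (Ee _ _).1].
move=> y Ey; have Ex := EW y Ey; have [By _] := Ey.
have Ax : carrier A (W y) by exact: Ex.1.
have Ay k : k \in [set j | l j = mu] -> carrier A (dot A (W y) (e k) *: e k).
  by move=> /set_mem lk; apply: (isometry_domZ hU); exact: (Ee k lk).1.
have := isometry_tends hU (fun n => (isometry_sum hU n Ay).1) Ax (eb _ Ex).
rewrite UW// /sums_to /=; congr tends; apply/funext => n /=.
rewrite (isometry_sum hU n Ay).2; apply: eq_bigr => k /set_mem lk.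
have Ak : carrier A (e k) by exact: (Ee k lk).1.
by rewrite (isometryZ hU)// -(isometry_dot hU)// UW.
Qed.

(** Unitarily equivalent operators have the same set of admissible lists, so the choice agrees
    whether or not a list is known to exist. *)
Lemma isometry_eigenvalues A B U W K K' :
  isometry A B U -> isometry B A W ->
  (forall x, carrier A x -> W (U x) = x) -> (forall y, carrier B y -> U (W y) = y) ->
  (forall x, carrier A x -> K' (U x) = U (K x)) ->
  (forall x, carrier A x -> carrier A (K x)) ->
  eigenvalues B K' = eigenvalues A K.
Proof.
move=> hU hW WU UW KK' AK; congr xget; apply/seteqP; split=> l /=; last first.
  exact: isometry_eigenvalue_list hU hW WU UW KK' AK.
have K'E y : carrier B y -> K' y = U (K (W y)).
  by move=> By; rewrite -KK' ?UW//; exact: (isometry_carrier hW).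
apply: (isometry_eigenvalue_list hW hU UW WU) => y By.
  by rewrite K'E// WU//; exact/AK/(isometry_carrier hW).
by rewrite K'E//; exact/(isometry_carrier hU)/AK/(isometry_carrier hW).
Qed.

End unitary.

Section reproducing_kernel.
Context {R : realType} {V : lmodType R}.
Variables (A : ipSpace V) (hA : inner_product A) (T : V -> V).
Variables (J : set nat) (phi : nat -> V) (lam : nat -> R).
Hypothesis T_basis : eigenbasis A T J phi lam.
Hypothesis T_diagonal : diagonal_operator A J phi lam T.
Variable Gamma : V -> V.
Hypothesis Gamma_diagonal : diagonal_operator A J phi (fun j => Num.sqrt (lam j)) Gamma.
Local Notation HK := (rkhs A T J phi lam).

Let phi_basis : orthonormal_basis A J phi. Proof. by case: T_basis. Qed.
Let lam_gt0 j : J j -> 0 < lam j. Proof. by case: T_basis => _ _ _ _; apply. Qed.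

(** The positive root of [T] and [Gamma] have the same multiplier sqrt(lam_j), hence the same image.
    The multiplier is bounded by its value at 0, or [J] is empty. *)
Lemma rkhs_carrierP f : carrier HK f <-> exists2 g, carrier A g & f = Gamma g.
Proof.
have [M lamM] : exists M, forall j, J j -> Num.sqrt (lam j) <= M.
  have [J0|J0] := pselect (J 0); last first.
    by exists 0 => j; case: T_basis => dn _ _ _ _ /(dn 0%N _ (leq0n j)).
  exists (Num.sqrt (lam 0%N)) => j Jj; rewrite ler_wsqrtr//.
  by case: T_basis => _ _ _ dec _; exact: dec.
have root : diagonal_operator A J phi (fun j => Num.sqrt (lam j)) (op_sqrt A T).
  apply: (op_sqrt_diagonal hA phi_basis Gamma_diagonal (M := M)) => [j Jj|x Ax].
    by rewrite sqrtr_ge0 lamM.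
  apply: (diagonal_eq (D2 := Gamma \o Gamma) hA phi_basis T_diagonal _ Ax).
  apply: eq_diagonal (diagonal_comp Gamma_diagonal Gamma_diagonal) => j Jj.
  by rewrite -expr2 sqr_sqrtr// ltW// lam_gt0.
by split=> -[g Ag ->]; exists g => //; [|apply/esym];
  exact: (diagonal_eq hA phi_basis root Gamma_diagonal Ag).
Qed.

(** The two factors sqrt(lam_j) cancel the weight 1 / lam_j, leaving the Parseval sum of [x] and
    [y]. *)
Lemma Gamma_isometry : isometry A HK Gamma.
Proof.
split.
- by split; [exact: (carrier0 hA) | exact: (carrier_lin hA)].
- by move=> x Ax; apply/rkhs_carrierP; exists x.
- exact: (diagonal_lin hA phi_basis Gamma_diagonal).
move=> x y Ax Ay /=; apply/cvg_lim => //.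
have := parseval hA phi_basis (y := y) Ax.
apply: cvg_trans; apply: near_eq_cvg; apply: nearW => n /=.
apply: eq_bigr => j /set_mem Jj; rewrite !Gamma_diagonal.2// mulrACA -expr2.
rewrite sqr_sqrtr ?ltW ?lam_gt0// mulrAC mulfV ?mul1r//.
by rewrite gt_eqF ?lam_gt0.
Qed.

Lemma Gamma_inj : {in carrier A &, injective Gamma}.
Proof.
move=> x y /set_mem Ax /set_mem Ay xy; apply: (basis_eq hA phi_basis) => // j Jj.
apply: (mulfI (x := Num.sqrt (lam j))).
  by rewrite gt_eqF// sqrtr_gt0 lam_gt0.
by rewrite -!Gamma_diagonal.2// xy.
Qed.

Variable W : V -> V.
Hypothesis W_Gamma : forall x, carrier A x -> W (Gamma x) = x.

Lemma Gamma_W y : carrier HK y -> Gamma (W y) = y.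
Proof. by move=> /rkhs_carrierP[x Ax ->]; rewrite W_Gamma. Qed.

Lemma Gamma_inv_isometry : isometry HK A W.
Proof.
have hG := Gamma_isometry.
split.
- split; first by apply/rkhs_carrierP; exists 0; [exact: (carrier0 hA)|
    rewrite (isometry0 hG)].
  move=> a _ _ /rkhs_carrierP[x Ax ->] /rkhs_carrierP[y Ay ->].
  apply/rkhs_carrierP; exists (a *: x + y); first exact: (carrier_lin hA).
  by rewrite (isometry_lin hG).
- by move=> _ /rkhs_carrierP[x Ax ->]; rewrite W_Gamma.
- move=> a _ _ /rkhs_carrierP[x Ax ->] /rkhs_carrierP[y Ay ->].
  by rewrite -(isometry_lin hG)// !W_Gamma//; exact: (carrier_lin hA).
- move=> _ _ /rkhs_carrierP[x Ax ->] /rkhs_carrierP[y Ay ->].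
  by rewrite !W_Gamma// (isometry_dot hG).
Qed.

End reproducing_kernel.

(** * L2 spaces and covariance operators *)

Section L2_inner_product.
Context {d} {T : measurableType d} {R : realType}.
Variable mu : {measure set T -> \bar R}.
Local Notation Lfun2 := (LfunType mu (lee1n 2)).

Lemma Lfun2_mul_integrable (f g : Lfun2) :
  mu.-integrable setT (EFin \o (fun x => f x * g x)).
Proof. by apply/Lfun1_integrable/Lfun2_mul_Lfun1; exact: LfunP. Qed.

Lemma L2_inner_product : inner_product (L2space mu).
Proof.
split=> //=; first split.
- by move=> x y; congr fine; apply: eq_integral => t _; rewrite mulrC.
- move=> a x y z; rewrite -[x]L2reprK -[y]L2reprK -[z]L2reprK.
  rewrite -[a *: _]/(L2scale a _) L2class_scale -L2classD !L2dotE.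
  rewrite -RintegralZl//; last exact: Lfun2_mul_integrable.
  rewrite -RintegralD//; [|exact: (integrableZl _ a (Lfun2_mul_integrable _ _))
    |exact: Lfun2_mul_integrable].
  apply: eq_Rintegral => t _ /=.
  by rewrite [X in X * _](_ : _ = a * L2repr x t + L2repr y t)//; ring.
- by move=> x; apply: Rintegral_ge0 => t _; rewrite -expr2 sqr_ge0.
- move=> x; rewrite /L2dot => x0; rewrite -[x]L2reprK.
  have iX := Lfun2_mul_integrable (L2repr x) (L2repr x).
  have mX := measurable_int _ iX.
  (* [L2dot] is the finite part of an extended integral; integrability ensures that its vanishing is
     that of the integral. *)
  have I0 : (\int[mu]_t `|(L2repr x t * L2repr x t)%:E| = 0)%E.
    transitivity (\int[mu]_t (L2repr x t * L2repr x t)%:E)%E.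
      by apply: eq_integral => t _; rewrite gee0_abs// lee_fin -expr2 sqr_ge0.
    by rewrite -[LHS]fineK; [congr (_%:E) | exact: integrable_fin_num].
  have /(ae_eq_integral_abs mu measurableT mX) := I0.
  move=> xx0; rewrite -[RHS](_ : L2class 0 = 0); last first.
    by apply: (addrI (L2class 0)); rewrite -L2classD !addr0.
  apply/L2classP; rewrite subr0; apply/asboolP.
  apply: filterS xx0 => t /(_ Logic.I) /= [] /eqP.
  by rewrite mulf_eq0 orbb => /eqP.
Qed.

End L2_inner_product.

Section covariance.
Context {dO} {Omega : measurableType dO} {R : realType} {V : lmodType R}.
Variables (P : probability Omega R) (A : ipSpace V) (hA : inner_product A).
Hypothesis carrierT : carrier A = setT.
Variables (X : Omega -> V) (S : V -> V).
Hypotheses (X_random : random_element A X) (S_cov : is_covariance P A X S).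

Let AT x : carrier A x. Proof. by rewrite carrierT. Qed.

Lemma covariance_integrable h g :
  P.-integrable setT (fun w => (dot A (X w) h * dot A (X w) g)%:E).
Proof.
have [_ /(_ _ (AT h))[_ /(_ _ (AT g))[+ _]]] := S_cov.
by congr integrable; apply/funext => w; rewrite (dotZl hA).
Qed.

Lemma covarianceE h g :
  ('E_P[fun w => (dot A (X w) h * dot A (X w) g)%R] = (dot A (S h) g)%:E)%E.
Proof.
have [_ /(_ _ (AT h))[_ /(_ _ (AT g))[_ <-]]] := S_cov.
by congr expectation; apply/funext => w; rewrite (dotZl hA).
Qed.

Lemma covariance_semidefinite : semidefinite (fun h g => dot A (S h) g).
Proof.
split=> [x y|a x y z|x].
- apply: EFin_inj; rewrite -!covarianceE; congr expectation; apply/funext => w.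
  exact: mulrC.
- have [[_ Slin _] _] := S_cov.
  by rewrite Slin// (dotDl hA) (dotZl hA).
- by rewrite -lee_fin -covarianceE; apply: expectation_ge0 => w; rewrite -expr2 sqr_ge0.
Qed.

(** The set of vectors of norm greater than [a] is open: by the triangle inequality it contains the
    ball of radius |x| - a around each of its points [x]. *)
Lemma measurable_ipnorm : measurable_fun setT (fun w => ipnorm A (X w)).
Proof.
apply: (measurability _ (RGenOInfty.measurableE R)) => //.
move=> _ [_ [a ->] <-]; rewrite setTI.
have -> : (fun w => ipnorm A (X w)) @^-1` `]a, +oo[%classic =
    X @^-1` [set x | a < ipnorm A x].
  by apply/seteqP; split=> w /=; rewrite in_itv/= andbT.
apply: X_random.2; split=> [x _|x /= ax]; first exact: AT.
exists (ipnorm A x - a); first by rewrite subr_gt0.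
move=> y _ yx; have := ler_ipnormD hA y (- (y - x)).
by rewrite opprB addrCA subrr addr0 -opprB (ipnormN hA); lra.
Qed.

(** The sum is the expectation of sum_j <X, e_j>^2, which Bessel bounds by |X|^2, and |X|^2 <= 1 +
    |X|^4 is integrable. *)
Lemma covariance_trace_bounded (J : set nat) e :
  (\int[P]_w (ipnorm A (X w) ^+ 4)%:E < +oo)%E -> orthonormal_family A J e ->
  exists tr, forall n, \sum_(j < n | (j : nat) \in J) dot A (S (e j)) (e j) <= tr.
Proof.
move=> X4 he.
pose I := (\int[P]_w (1 + ipnorm A (X w) ^+ 4)%:E)%E.
have Ifin : I \is a fin_num.
  rewrite ge0_fin_numE; last first.
    by apply: integral_ge0 => w _; rewrite lee_fin addr_ge0// exprn_ge0// ipnorm_ge0.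
  rewrite /I; under eq_integral do rewrite EFinD.
  rewrite ge0_integralD//=.
  - by rewrite integral_cst//= probability_setT mule1 lte_add_pinfty// ltry.
  - by move=> w _; rewrite lee_fin exprn_ge0// ipnorm_ge0.
  - apply/measurable_EFinP; apply: measurable_funX; exact: measurable_ipnorm.
exists (fine I) => n; rewrite -lee_fin fineK//.
rewrite -sumEFin.
under eq_bigr do rewrite -covarianceE unlock.
rewrite -big_filter -ge0_integral_sum//; first last.
- by move=> j w _; rewrite lee_fin -expr2 sqr_ge0.
- by move=> j; exact: measurable_int (covariance_integrable _ _).
apply: ge0_le_integral => //.
- by move=> w _; apply: sume_ge0 => j _; rewrite lee_fin -expr2 sqr_ge0.
- by apply: emeasurable_sum => j; exact: measurable_int (covariance_integrable _ _).
- apply/measurable_EFinP; apply: measurable_funD => //; apply: measurable_funX.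
  exact: measurable_ipnorm.
- move=> w _; rewrite sumEFin lee_fin big_filter.
  under eq_bigr do rewrite -expr2.
  apply: (le_trans (bessel hA he (X w) n)); rewrite -(ipnorm_sqr hA).
  have := sqr_ge0 (ipnorm A (X w) ^+ 2 - 1); rewrite sqrrB -exprM.
  have := sqr_ge0 (ipnorm A (X w)); lra.
Qed.

End covariance.

(** If lam_j >= c, the [j] values before it are also at least [c], so j c <= tr. *)
Lemma trace_bounded_finite {R : realType} (J : set nat) (lam : nat -> R) tr :
  (forall j k, (j <= k)%N -> J k -> J j) ->
  (forall j k, (j <= k)%N -> J k -> lam k <= lam j) ->
  (forall n, \sum_(j < n | (j : nat) \in J) lam j <= tr) ->
  forall c, 0 < c -> exists N, forall j, J j -> c <= lam j -> (j < N)%N.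
Proof.
move=> Jdn dec trle c c0.
exists (Num.Def.archi_bound (tr / c)) => j Jj cj.
rewrite -(ltr_nat R); apply: le_lt_trans (archi_boundP _); last first.
  by rewrite divr_ge0 ?(ltW c0)//; have := trle 0%N; rewrite big_ord0.
rewrite ler_pdivlMr//; apply: le_trans (trle j).
have -> : j%:R * c = \sum_(i < j) c by rewrite sumr_const card_ord mulr_natl.
rewrite [leRHS]big_mkcond/=; apply: ler_sum => i _.
have ij : (i <= j)%N by exact: ltnW.
by rewrite mem_set; [exact: le_trans cj (dec _ _ ij Jj) | exact: Jdn ij Jj].
Qed.

Lemma orthproj_spec {R : realType} {V : lmodType R} (A : ipSpace V) (D : set V) x :
  inner_product A -> (exists2 p, D p & forall q, D q -> dot A (x - p) q = 0) ->
  D (orthproj A D x) /\ forall q, D q -> dot A (orthproj A D x) q = dot A x q.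
Proof.
move=> hA [p Dp hp].
have [Do ho] : [set p | D p /\ forall q, D q -> dot A (x - p) q = 0] (orthproj A D x).
  by apply: xgetPex; exists p.
split=> // q Dq; apply/esym/eqP; rewrite -subr_eq0 -(dotBl hA).
by apply/eqP/ho.
Qed.

Section adjoints.
Context {R : realType} {V : lmodType R}.
Variables (A B : ipSpace V) (hA : inner_product A) (hB : inner_product B).
Variables (C C' : V -> V).
Hypothesis C_adj : is_adjoint A B C C'.

Lemma adjoint_lin a x y : carrier B x -> carrier B y ->
  C' (a *: x + y) = a *: C' x + C' y.
Proof.
have [C'A adj] := C_adj => Bx By; have Bxy := carrier_lin hB a Bx By.
apply: (ip_eq hA) => [||z Az]; first exact: C'A.
  by apply: (carrier_lin hA); exact: C'A.
rewrite (dotDl hA) (dotZl hA) !(dotC hA _ z) -!adj//.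
by rewrite (dotDr hB) (dotZr hB).
Qed.

Lemma adjoint_contraction :
  (forall x y, carrier A x -> carrier B y ->
    dot B (C x) y <= ipnorm A x * ipnorm B y) ->
  forall y, carrier B y -> ipnorm A (C' y) <= ipnorm B y.
Proof.
have [C'A adj] := C_adj => C1 y By.
have [y0|y0] := eqVneq (ipnorm A (C' y)) 0; first by rewrite y0 ipnorm_ge0.
have yp : 0 < ipnorm A (C' y) by rewrite lt_def y0 ipnorm_ge0.
rewrite -(ler_pM2l yp) -expr2 (ipnorm_sqr hA) -adj//; last exact: C'A.
by apply: C1 => //; exact: C'A.
Qed.

End adjoints.

(** * Eigenvalues of compressions *)

Section comparison.
Context {R : realType} {V : lmodType R}.
Variables (A : ipSpace V) (hA : inner_product A).

(** The lower half of Courant-Fischer: on the first j + 1 eigenvectors every weight is at least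
    l_j. *)
Lemma svd_form_span K l e j (a : 'I_j.+1 -> R) : is_svd A A K l e e -> l j != 0 ->
  let x := \sum_i a i *: e i in
  carrier A x /\ l j * (\sum_i a i ^+ 2) <= dot A (K x) x.
Proof.
move=> hK lj x; have [dec _ he _ _] := hK.
have lnz (i : 'I_j.+1) : l i != 0.
  by rewrite gt_eqF// (lt_le_trans _ (dec _ _ (ltn_ord i : (i <= j)%N)))// lt_def lj
    (svd_ge0 hK).
have Ax : carrier A x.
  by apply: (carrier_sum hA) => i _; apply: (carrierZ hA); exact/he.1/lnz.
split=> //; rewrite {2}/x (dot_sumr hA) mulr_sumr; apply: ler_sum => i _.
rewrite (dotZr hA) (svd_coef hA hK)// (_ : dot A (e i) x = a i).
  rewrite [leRHS]mulrCA -expr2 ler_wpM2r ?sqr_ge0//; apply: dec.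
  by rewrite -ltnS.
rewrite (dot_sumr hA) (bigD1 i)//= big1 ?addr0 => [|k ki];
  rewrite (dotZr hA) he.2 ?lnz ?eqxx ?mulr1//; try exact: lnz.
by rewrite eq_sym (inj_eq val_inj) (negbTE ki) mulr0.
Qed.

Lemma svd_orthonormal_prefix K l e j : is_svd A A K l e e -> l j != 0 ->
  (forall i : 'I_j.+1, carrier A (e i)) /\
  forall i k : 'I_j.+1, dot A (e i) (e k) = (i == k)%:R.
Proof.
move=> hK lj; have [dec _ he _ _] := hK.
have lnz (i : 'I_j.+1) : l i != 0.
  by rewrite gt_eqF// (lt_le_trans _ (dec _ _ (ltn_ord i : (i <= j)%N)))// lt_def lj
    (svd_ge0 hK).
split=> [i|i k]; first exact/he.1/lnz.
by rewrite he.2; [rewrite (inj_eq val_inj) | exact: lnz | exact: lnz].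
Qed.

(** The span of the first j + 1 vectors [e'] lies in [F], where the form of [K] dominates that of
    [K'] and hence l'_j; min-max then applies to [K]. [F] will be the range of a projection. *)
Lemma svd_compare K K' l l' e e' (F : set V) :
  is_svd A A K l e e -> is_svd A A K' l' e' e' ->
  (forall n (a : 'I_n -> R) (u : 'I_n -> V), (forall i, F (u i)) ->
    F (\sum_i a i *: u i)) ->
  (forall k, l' k != 0 -> F (e' k)) ->
  (forall x, carrier A x -> F x -> dot A (K' x) x <= dot A (K x) x) ->
  forall j, l' j <= l j.
Proof.
move=> hK hK' Flin Fe le j.
have [->|lj] := eqVneq (l' j) 0; first exact: (svd_ge0 hK).
have [Ae ee] := svd_orthonormal_prefix hK' lj.
apply: (svd_minmax hA hK (u := fun i : 'I_j.+1 => e' i)) => // a /=.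
have [Ax lx] := svd_form_span a hK' lj.
apply: (le_trans lx); apply: le => //; apply: Flin => i; apply: Fe.
have [dec _ _ _ _] := hK'.
by rewrite gt_eqF// (lt_le_trans _ (dec _ _ (ltn_ord i : (i <= j)%N)))// lt_def lj
  (svd_ge0 hK').
Qed.

Lemma tends_dot2 u v x y : tends A u x -> tends A v y ->
  dot A (u n) (v n) @[n --> \oo] --> dot A x y.
Proof.
move=> ux vy; apply/subr_cvg0; apply: norm_cvg0.
apply: (@squeeze_cvgr _ _ _ _ (cst 0)
  (fun n => ipnorm A (u n - x) * ipnorm A (v n) + ipnorm A x * ipnorm A (v n - y))).
- apply: nearW => n /=; rewrite normr_ge0/=.
  have -> : dot A (u n) (v n) - dot A x y =
      dot A (u n - x) (v n) + dot A x (v n - y).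
    by rewrite (dotBl hA) (dotBr hA); ring.
  by apply: (le_trans (ler_normD _ _)); apply: lerD; apply: cauchy_schwarz.
- exact: cvg_cst.
- have -> : 0 = 0 * ipnorm A y + ipnorm A x * 0 by rewrite mul0r mulr0 addr0.
  by apply: cvgD; [apply: cvgM => //; exact: tends_ipnorm | exact: cvgMr].
Qed.

(** On the span of the first j + 1 eigenvectors of [K], the forms of [K] and [Km m] differ by at
    most sum |delta| times the sum of the squared coefficients, so min-max gives lm_j >= l_j - sum
    |delta|. *)
Lemma svd_cvg K l e (Km : nat -> V -> V) lm em :
  is_svd A A K l e e -> (forall m, is_svd A A (Km m) (lm m) (em m) (em m)) ->
  (forall a x y, carrier A x -> carrier A y -> K (a *: x + y) = a *: K x + K y) ->
  (forall m a x y, carrier A x -> carrier A y ->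
    Km m (a *: x + y) = a *: Km m x + Km m y) ->
  (forall x y, carrier A x -> carrier A y ->
    dot A (Km m x) y @[m --> \oo] --> dot A (K x) y) ->
  (forall m j, lm m j <= l j) ->
  forall j, lm m j @[m --> \oo] --> l j.
Proof.
move=> hK hKm Klin Kmlin weak le j.
have [lj|lj] := eqVneq (l j) 0.
  apply: (@cvg_eventually_cst _ _ 0%N) => m _; apply/eqP.
  by rewrite eq_le le lj (svd_ge0 (hKm m)).
have [Ae ee] := svd_orthonormal_prefix hK lj.
pose delta m (i k : 'I_j.+1) := dot A (Km m (e i)) (e k) - dot A (K (e i)) (e k).
apply: (@squeeze_cvgr _ _ _ _
  (fun m => l j - \sum_(i < j.+1) \sum_(k < j.+1) `|delta m i k|) (cst (l j))).
- apply: nearW => m /=; rewrite le andbT.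
  apply: (svd_minmax hA (hKm m) (u := fun i : 'I_j.+1 => e i)) => // a /=.
  set x := \sum_i a i *: e i.
  have [Ax lx] := svd_form_span a hK lj.
  rewrite mulrBl lerBlDr; apply: (le_trans lx); rewrite -/x -lerBlDl.
  have form T : (forall a x y, carrier A x -> carrier A y ->
      T (a *: x + y) = a *: T x + T y) ->
      dot A (T x) x = \sum_i \sum_k a i * a k * dot A (T (e i)) (e k).
    move=> Tlin; rewrite (linear_sum hA Tlin)// (dot_suml hA).
    apply: eq_bigr => i _; rewrite (dot_sumr hA); apply: eq_bigr => k _.
    by rewrite (dotZl hA) (dotZr hA) mulrA.
  rewrite !form//; last exact: Kmlin.
  rewrite -sumrB mulr_suml; apply: ler_sum => i _.
  rewrite -sumrB mulr_suml; apply: ler_sum => k _.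
  rewrite -mulrBr -[dot _ _ _ - _]opprB -/(delta m i k) mulrN.
  apply: le_trans (ler_norm _) _; rewrite normrN normrM mulrC ler_wpM2l//.
  have ai i0 : a i0 ^+ 2 <= \sum_i a i ^+ 2.
    by rewrite (bigD1 i0)//= lerDl sumr_ge0// => *; exact: sqr_ge0.
  (* Here |a_i| |a_k| <= (a_i^2 + a_k^2) / 2, which is at most the full sum of squares. *)
  rewrite normrM; have := sqr_ge0 (`|a i| - `|a k|).
  have := ai i; have := ai k; rewrite sqrrB !real_normK ?num_real//; lra.
- rewrite -[X in _ --> X](subr0 (l j)); apply: cvgB; first exact: cvg_cst.
  rewrite -[X in _ --> X](_ : \sum_(i < j.+1) \sum_(k < j.+1) (0 : R) = 0); last first.
    by rewrite big1// => i _; rewrite big1.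
  apply: cvg_big => [|i _]; first exact: add_continuous.
  apply: cvg_big => [|k _]; first exact: add_continuous.
  rewrite -(@normr0 _ R); apply: cvg_norm; apply/subr_cvg0; exact: weak.
- exact: cvg_cst.
Qed.

End comparison.

Section compressions.
Context {R : realType} {V : lmodType R}.
Variables (A B : ipSpace V) (hA : inner_product A) (hB : inner_product B).
Variables (I J : set nat) (phi psi : nat -> V).
Hypotheses (phi_basis : orthonormal_basis A I phi)
           (psi_basis : orthonormal_basis B J psi).
Hypothesis I_initial : forall j k, (j <= k)%N -> I k -> I j.
Variables (p q : nat -> nat -> bool) (Pi Qi : nat -> V -> V).
Hypotheses (Pi_diag : forall m, diagonal_operator A I phi (fun j => (p m j)%:R) (Pi m))
           (Qi_diag : forall m, diagonal_operator B J psi (fun j => (q m j)%:R) (Qi m)).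
Hypotheses (p_mono : forall m n j, (m <= n)%N -> p m j -> p n j)
           (q_mono : forall m n j, (m <= n)%N -> q m j -> q n j).
Hypotheses (p_all : forall j, I j -> exists m0, forall m, (m0 <= m)%N -> p m j)
           (q_all : forall j, J j -> exists m0, forall m, (m0 <= m)%N -> q m j).
Hypothesis p_fin : forall m, exists N, forall j, I j -> p m j -> (j < N)%N.
Variables (C C' : V -> V) (rho : nat -> R) (g f : nat -> V).
Hypotheses (C_carrier : forall y, carrier B y -> carrier A (C y))
  (C_lin : forall a x y, carrier B x -> carrier B y ->
     C (a *: x + y) = a *: C x + C y)
  (C_adj : is_adjoint B A C C') (C_svd : is_svd B A C rho g f)
  (C_contr : forall y x, carrier B y -> carrier A x ->
     dot A (C y) x <= ipnorm B y * ipnorm A x).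

Let K := C \o C'.
Let Bm m y := Pi m (C (Qi m y)).
Let Bm' m x := Qi m (C' (Pi m x)).
Let Km m := Bm m \o Bm' m.

Let C'B x : carrier A x -> carrier B (C' x). Proof. exact: C_adj.1. Qed.
Let PA m x : carrier A x -> carrier A (Pi m x). Proof. exact: (Pi_diag m).1. Qed.
Let QB m x : carrier B x -> carrier B (Qi m x). Proof. exact: (Qi_diag m).1. Qed.
Let BmA m y : carrier B y -> carrier A (Bm m y).
Proof. by move=> By; exact/PA/C_carrier/QB. Qed.
Let BmB m x : carrier A x -> carrier B (Bm' m x).
Proof. by move=> Ax; exact/QB/C'B/PA. Qed.

Let C'_lin a x y : carrier A x -> carrier A y -> C' (a *: x + y) = a *: C' x + C' y.
Proof. exact: (adjoint_lin hB hA C_adj). Qed.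

Let P_lin m := diagonal_lin hA phi_basis (Pi_diag m).
Let Q_lin m := diagonal_lin hB psi_basis (Qi_diag m).

Lemma compression_adjoint m : is_adjoint B A (Bm m) (Bm' m).
Proof.
split=> [x|y x By Ax]; first exact: BmB.
have [_ padj] := diagonal_adjoint hA phi_basis (Pi_diag m).
have [_ qadj] := diagonal_adjoint hB psi_basis (Qi_diag m).
rewrite padj//; last exact/C_carrier/QB.
by rewrite C_adj.2 ?qadj//; [exact/C'B/PA|exact: QB|exact: PA].
Qed.

Let Bm'_lin m a x y : carrier A x -> carrier A y ->
  Bm' m (a *: x + y) = a *: Bm' m x + Bm' m y.
Proof. exact: (adjoint_lin hB hA (compression_adjoint m)). Qed.

Let Km_lin m a x y : carrier A x -> carrier A y ->
  Km m (a *: x + y) = a *: Km m x + Km m y.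
Proof.
move=> Ax Ay; have Bx := BmB m Ax; have By := BmB m Ay.
rewrite /Km /= Bm'_lin// /Bm Q_lin// C_lin; [|exact: QB|exact: QB].
by rewrite P_lin//; exact/C_carrier/QB.
Qed.

Let K_lin a x y : carrier A x -> carrier A y -> K (a *: x + y) = a *: K x + K y.
Proof. by move=> Ax Ay; rewrite /K /= C'_lin// C_lin//; exact: C'B. Qed.

Let Km_form m x y : carrier A x -> carrier A y ->
  dot A (Km m x) y = dot B (Bm' m x) (Bm' m y).
Proof. by move=> Ax Ay; rewrite (compression_adjoint m).2//; exact: BmB. Qed.

Let K_form x y : carrier A x -> carrier A y -> dot A (K x) y = dot B (C' x) (C' y).
Proof. by move=> Ax Ay; rewrite C_adj.2//; exact: C'B. Qed.

(** Turns the part of [I] below [N] into an ordinal, the index type of [finite_rank_svd]. *)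
Let initial_segment N : exists n, forall j, (j < n)%N <-> I j /\ (j < N)%N.
Proof.
elim: N => [|N [n IH]]; first by exists 0%N => j; split=> [//|[]].
have [IN|IN] := pselect (I N).
  exists N.+1 => j; split=> [jN|[]//]; split=> //.
  by apply: I_initial IN; rewrite -ltnS.
exists n => j; rewrite IH [(j < N.+1)%N]ltnS (leq_eqVlt j N); split=> [[Ij ->]|[Ij]].
  by rewrite orbT.
by move=> /orP[/eqP jN|//]; rewrite jN in Ij.
Qed.

(** The outer factor [Pi m] keeps finitely many coordinates, so the range of [Km m] lies in the span
    of an initial part of the basis. *)
Lemma compression_svd m : exists l e, is_svd A A (Km m) l e e.
Proof.
have [N hN] := p_fin m; have [n hn] := initial_segment N.
have In (i : 'I_n) : I i by have /hn[] := ltn_ord i.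
apply: (@finite_rank_svd _ _ A (Km m) n (fun i => phi i)) => //.
- by move=> x Ax; exact/BmA/BmB.
- by move=> a x y; exact: Km_lin.
- split=> [x Ax|x y Ax Ay]; first exact/BmA/BmB.
  rewrite Km_form// (dotC hA) Km_form// (dotC hB).
  by [].
- by move=> x Ax; rewrite Km_form// (form_ge0 (ip_form hB)).
- by move=> i; exact: phi_basis.1.1.
- by move=> i j; rewrite phi_basis.1.2.
move=> x Ax; have AKx : carrier A (Km m x) by exact/BmA/BmB.
apply: (basis_eq hA phi_basis) => // [|j Ij].
  by apply: (carrier_sum hA) => i _; apply: (carrierZ hA); exact: phi_basis.1.1.
rewrite (dot_suml hA); have [jn|jn] := boolP (j < n)%N.
  rewrite (bigD1 (Ordinal jn))//= (dotZl hA) phi_basis.1.2// eqxx mulr1 big1 ?addr0//.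
  move=> i; rewrite -(inj_eq val_inj)/= => ij.
  by rewrite (dotZl hA) phi_basis.1.2// (negbTE ij) mulr0.
rewrite big1 => [|i _].
  rewrite /Km /= /Bm (Pi_diag m).2//; last exact/C_carrier/QB/BmB.
  case: (boolP (p m j)) => [/(hN j Ij) jN|_]; last by rewrite mul0r.
  by case/negP: jn; apply/hn.
rewrite (dotZl hA) phi_basis.1.2//; case: eqP => [ij|_]; last by rewrite mulr0.
by rewrite -ij ltn_ord in jn.
Qed.

Let fixed m := [set x | carrier A x /\ Pi m x = x].

Let fixed_sum m n (a : 'I_n -> R) (u : 'I_n -> V) : (forall i, fixed m (u i)) ->
  fixed m (\sum_i a i *: u i).
Proof.
move=> hu; split.
  by apply: (carrier_sum hA) => i _; apply: (carrierZ hA); exact: (hu i).1.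
rewrite (linear_sum hA (P_lin m)) => [|i]; last exact: (hu i).1.
by apply: eq_bigr => i _; rewrite (hu i).2.
Qed.

Let fixed_mono m n x : (m <= n)%N -> fixed m x -> fixed n x.
Proof.
move=> mn [Ax Px]; split=> //; rewrite -{2}Px -[in LHS]Px.
apply: (diagonal_eq (D1 := Pi n \o Pi m) hA phi_basis _ (Pi_diag m) Ax).
apply: eq_diagonal (diagonal_comp (Pi_diag n) (Pi_diag m)) => j _.
case: (boolP (p m j)) => pm; last by rewrite mulr0.
by rewrite (p_mono mn pm) mulr1.
Qed.

Let fixed_eigenvector m l e k : is_svd A A (Km m) l e e -> l k != 0 -> fixed m (e k).
Proof.
move=> hK lk; have [_ _ he _ _] := hK; have Ae := he.1 k lk.
have : e k = (l k)^-1 *: Km m (e k).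
  by rewrite (svd_singular hA hK)// scalerA mulVf// scale1r.
split=> //; apply: (basis_eq hA phi_basis) => [|//|j Ij]; first exact: PA.
rewrite (Pi_diag m).2// H !(dotZl hA) /Km /= /Bm (Pi_diag m).2//.
  by case: p; rewrite ?mul1r ?mul0r ?mulr0.
exact/C_carrier/QB/BmB.
Qed.

(** Q_m = Q_m Q_n, and Q_m is a contraction. *)
Let Qi_le m n y : (m <= n)%N -> carrier B y ->
  dot B (Qi m y) (Qi m y) <= dot B (Qi n y) (Qi n y).
Proof.
move=> mn By; rewrite -!(ipnorm_sqr hB) lerXn2r ?nnegrE ?ipnorm_ge0//.
have -> : Qi m y = Qi m (Qi n y).
  apply: (diagonal_eq (D2 := Qi m \o Qi n) hB psi_basis (Qi_diag m) _ By).
  apply: eq_diagonal (diagonal_comp (Qi_diag m) (Qi_diag n)) => j _.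
  case: (boolP (q m j)) => qm; last by rewrite mul0r.
  by rewrite (q_mono mn qm) mulr1.
rewrite -[leRHS]mul1r; apply: (diagonal_norm hB psi_basis (Qi_diag m)) => //.
  by move=> j _; rewrite normr_nat lern1 leq_b1.
exact: QB.
Qed.

Let Qi_contr m y : carrier B y -> ipnorm B (Qi m y) <= ipnorm B y.
Proof.
move=> By; rewrite -[leRHS]mul1r; apply: (diagonal_norm hB psi_basis (Qi_diag m)) => //.
by move=> j _; rewrite normr_nat lern1 leq_b1.
Qed.

Let C'_contr x : carrier A x -> ipnorm B (C' x) <= ipnorm A x.
Proof. exact: (adjoint_contraction hB C_adj C_contr). Qed.

(** Q_m C' P_m x - C' x splits into Q_m C' (P_m x - x) and Q_m C' x - C' x; the first is at most
    |P_m x - x| because Q_m and C' are contractions. *)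
Lemma compression_cvg x : carrier A x -> tends B (fun m => Bm' m x) (C' x).
Proof.
move=> Ax; have By := C'B Ax.
have b01 (b : bool) : 0 <= (b%:R : R) <= 1 by rewrite ler0n lern1 leq_b1.
have Px : tends A (fun m => Pi m x) x.
  apply: (diagonal_cvg hA phi_basis Pi_diag) => // j Ij.
  by have [m0 h] := p_all Ij; exists m0 => m /h ->.
have Qx : tends B (fun m => Qi m (C' x)) (C' x).
  apply: (diagonal_cvg hB psi_basis Qi_diag) => // j Ij.
  by have [m0 h] := q_all Ij; exists m0 => m /h ->.
apply: (tends_dominated
  (a := fun m => ipnorm A (Pi m x - x) + ipnorm B (Qi m (C' x) - C' x))).
  by rewrite -[X in _ --> X](addr0 0); apply: cvgD.
move=> m; have AP := PA m Ax.
have -> : Bm' m x - C' x = Qi m (C' (Pi m x - x)) + (Qi m (C' x) - C' x).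
  have -> : Pi m x - x = -1 *: x + Pi m x by rewrite addrC scaleN1r.
  rewrite C'_lin// Q_lin; [|exact: C'B|exact: C'B].
  by rewrite scaleN1r [- _ + _]addrC subrKA.
apply: (le_trans (ler_ipnormD hB _ _)); rewrite lerD2r.
have APx := carrierB hA AP Ax.
by apply: le_trans (C'_contr APx); apply: Qi_contr; exact: C'B.
Qed.

(** On the range of P_m the form of [Km m] is |Q_m C' x|^2. It is at most |Q_n C' x|^2, the form of
    [Km n] there, and at most |C' x|^2, the form of [K]. The bound by 1 is rho_j = <C g_j, f_j> <=
    1. *)
Theorem compression_eigenvalues j :
  [/\ forall m, 0 <= eigenvalues A (Km m) j,
      forall m n, (m <= n)%N -> eigenvalues A (Km m) j <= eigenvalues A (Km n) j,
      eigenvalues A (Km m) j @[m --> \oo] --> eigenvalues A K j &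
      eigenvalues A K j <= 1].
Proof.
have hK : is_svd A A K (fun k => rho k ^+ 2) f f.
  exact: (svd_gram hA C_svd C_adj).
have [lm hlm] := choice compression_svd; have [em hKm] := choice hlm.
have lmE m : eigenvalues A (Km m) = lm m.
  exact: (eigenvalues_svd hA (Km_lin m) (hKm m)).
have KE := eigenvalues_svd hA K_lin hK.
rewrite KE; under eq_fun do rewrite lmE.
split=> [m|m n mn||].
- by rewrite lmE (svd_ge0 (hKm m)).
- rewrite !lmE; apply: (svd_compare hA (hKm n) (hKm m) (F := fixed m)).
  + by move=> k a u; exact: fixed_sum.
  + by move=> k; exact: fixed_eigenvector.
  + move=> x Ax xm; have [_ xn] := fixed_mono mn xm; have [_ {}xm] := xm.
    by rewrite !Km_form// /Bm' xm xn; apply: Qi_le => //; exact: C'B.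
- apply: (svd_cvg hA hK hKm) => //.
    move=> x y Ax Ay; rewrite K_form//; under eq_fun do rewrite Km_form//.
    by apply: (tends_dot2 hB); exact: compression_cvg.
  move=> m; apply: (svd_compare hA hK (hKm m) (F := fixed m)).
  + by move=> k a u; exact: fixed_sum.
  + by move=> k; exact: fixed_eigenvector.
  + move=> x Ax [_ xm]; rewrite Km_form// K_form// /Bm' xm -!(ipnorm_sqr hB).
    by rewrite lerXn2r ?nnegrE ?ipnorm_ge0// Qi_contr//; exact: C'B.
- have [->|rj] := eqVneq (rho j) 0; first by rewrite expr0n.
  have [_ _ hg hf _] := C_svd.
  rewrite expr_le1 ?(svd_ge0 C_svd)//.
  have := C_contr (hg.1 j rj) (hf.1 j rj).
  rewrite (svd_singular hA C_svd)// (dotZl hA) /ipnorm hg.2// hf.2// eqxx.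
  by rewrite sqrtr1 !mulr1.
Qed.

End compressions.

(** * The blocks of the covariance operator *)

Section covariance_blocks.
Context {R : realType} {V : lmodType R}.
Variables (H : ipSpace V) (hH : inner_product H).
Hypothesis carrierT : carrier H = setT.

Lemma ip_restrict_inner_product D : closed_subspace H D ->
  inner_product (ip_restrict H D).
Proof.
move=> [_ D0 Dlin _]; split=> //; [exact: (ip_form hH) | exact: (ip_def hH)].
Qed.

Variables (S : V -> V) (S_semi : semidefinite (fun h g => dot H (S h) g)).

Section one_block.
Variables (D : set V) (D_closed : closed_subspace H D).
Hypothesis D_proj : forall x : V, exists2 p, D p & forall q, D q -> dot H (x - p) q = 0.
Local Notation Y := (orthproj H D).
Local Notation HD := (ip_restrict H D).
Let SD x := Y (S (Y x)).
Let hD : inner_product HD. Proof. exact: ip_restrict_inner_product. Qed.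

Lemma orthproj_in x : D (Y x). Proof. exact: (orthproj_spec hH (D_proj x)).1. Qed.

Lemma orthproj_dot x z : D z -> dot H (Y x) z = dot H x z.
Proof. exact: (orthproj_spec hH (D_proj x)).2. Qed.

Lemma orthproj_id x : D x -> Y x = x.
Proof.
move=> Dx; apply: (ip_eq hD) => //; first exact: orthproj_in.
by move=> z Dz; exact: orthproj_dot.
Qed.

Variables (J : set nat) (phi : nat -> V) (lam : nat -> R).
Hypothesis SD_basis : eigenbasis HD SD J phi lam.
Let phi_basis : orthonormal_basis HD J phi. Proof. by case: SD_basis. Qed.
Let lam_gt0 j : J j -> 0 < lam j. Proof. by case: SD_basis => _ _ _ _; apply. Qed.

Lemma block_dot x z : D x -> D z -> dot H (SD x) z = dot H (S x) z.
Proof. by move=> Dx Dz; rewrite /SD orthproj_dot// orthproj_id. Qed.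

(** By symmetry of S, <S x, phi_j> = <x, S phi_j>, tested within the block, equals lam_j <x,
    phi_j>. *)
Lemma block_diagonal : diagonal_operator HD J phi lam SD.
Proof.
split=> [x _|x j Dx Jj]; first exact: orthproj_in.
have Dj : D (phi j) by exact: phi_basis.1.1.
rewrite /= block_dot// (form_sym S_semi) -block_dot//.
by case: SD_basis => _ _ -> // _ _; rewrite (dotZl hH) (dotC hH).
Qed.

Lemma covariance_basis i j : J i -> J j ->
  dot H (S (phi i)) (phi j) = lam i * (i == j)%:R.
Proof.
move=> Ji Jj; have Di : D (phi i) by exact: phi_basis.1.1.
have Dj : D (phi j) by exact: phi_basis.1.1.
rewrite -block_dot//; case: SD_basis => _ _ -> // _ _.
by rewrite (dotZl hH) [dot _ _ _](phi_basis.1.2 i j).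
Qed.

Lemma Gamma_diagonal Gamma : is_Gamma HD J phi lam Gamma ->
  diagonal_operator HD J phi (fun j => Num.sqrt (lam j)) Gamma.
Proof.
move=> hG; have [_ _ _ Dlim] := D_closed.
split=> [x Dx|x j Dx Jj].
  (* The limit defining [Gamma x] stays in [D] because [D] is closed. *)
  apply: Dlim (hG x Dx); last by rewrite carrierT.
  move=> n; apply: (carrier_sum hD) => k /set_mem Jk; apply: (carrierZ hD).
  exact: phi_basis.1.1.
apply: (cvg_unique _ (tends_dot hD (phi j) (hG x Dx))) => //.
apply: (@cvg_eventually_cst _ _ j.+1) => n jn.
rewrite (dot_orthonormal_sum hD phi_basis.1
  (fun j => Num.sqrt (lam j) * dot HD x (phi j)))//.
by rewrite jn.
Qed.

(** [a] truncates the formal expansion of S_D^(-1/2) u, which may diverge. The factor lam_j of the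
    form cancels the square of 1 / sqrt(lam_j), leaving a Bessel sum of [u]. *)
Lemma root_combination_form u k : D u ->
  let a := \sum_(j < k | (j : nat) \in J) (dot H u (phi j) / Num.sqrt (lam j)) *: phi j in
  dot H (S a) a <= dot H u u.
Proof.
move=> Du /=; set a := \sum_(_ < _ | _) _.
apply: le_trans (bessel hD phi_basis.1 u k).
rewrite (form_sumr S_semi) le_eqVlt; apply/orP; left; apply/eqP.
apply: eq_bigr => j /set_mem Jj; rewrite (formZr S_semi) (form_suml S_semi).
rewrite (bigD1 j) ?mem_set//= big1 ?addr0 => [|i /andP[/set_mem Ji ij]].
  rewrite (formZl S_semi) covariance_basis// eqxx mulr1.
  have := lam_gt0 Jj; rewrite -sqrtr_gt0 => s0.
  have := sqr_sqrtr (ltW (lam_gt0 Jj)); move: (Num.sqrt _) s0 => s s0 <-.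
  by field; rewrite gt_eqF.
by rewrite (formZl S_semi) covariance_basis// (inj_eq val_inj) (negbTE ij) !mulr0.
Qed.

End one_block.

Section two_blocks.
Variables (D1 D2 : set V).
Hypotheses (D1_closed : closed_subspace H D1) (D2_closed : closed_subspace H D2).
Hypothesis D1_proj :
  forall x : V, exists2 p, D1 p & forall q, D1 q -> dot H (x - p) q = 0.
Hypothesis D2_proj :
  forall x : V, exists2 p, D2 p & forall q, D2 q -> dot H (x - p) q = 0.
Local Notation H1 := (ip_restrict H D1).
Local Notation H2 := (ip_restrict H D2).
Local Notation Y1 := (orthproj H D1).
Local Notation Y2 := (orthproj H D2).
Variables (J1 J2 : set nat) (phi1 phi2 : nat -> V) (lam1 lam2 : nat -> R).
Hypotheses (phi1_basis : eigenbasis H1 (fun x => Y1 (S (Y1 x))) J1 phi1 lam1)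
           (phi2_basis : eigenbasis H2 (fun x => Y2 (S (Y2 x))) J2 phi2 lam2).
Variables (C C' : V -> V) (C_adj : is_adjoint H2 H1 C C').
Hypothesis C_def : forall j k, J1 j -> J2 k ->
  dot H (C (phi2 k)) (phi1 j) = dot H (S (phi1 j)) (phi2 k) / Num.sqrt (lam1 j * lam2 k).
Hypothesis C_carrier : forall y, D2 y -> D1 (C y).

Let hD1 : inner_product H1. Proof. exact: ip_restrict_inner_product. Qed.
Let hD2 : inner_product H2. Proof. exact: ip_restrict_inner_product. Qed.
Let b1 : orthonormal_basis H1 J1 phi1. Proof. by case: phi1_basis. Qed.
Let b2 : orthonormal_basis H2 J2 phi2. Proof. by case: phi2_basis. Qed.
Let lam1_gt0 j : J1 j -> 0 < lam1 j. Proof. by case: phi1_basis => _ _ _ _; apply. Qed.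
Let lam2_gt0 j : J2 j -> 0 < lam2 j. Proof. by case: phi2_basis => _ _ _ _; apply. Qed.

(* Cauchy-Schwarz for the covariance form, applied to truncations of
   [S_1^(-1/2) u] and [S_2^(-1/2) v]. *)
Lemma covariance_contraction v u : D2 v -> D1 u ->
  dot H (C v) u <= ipnorm H v * ipnorm H u.
Proof.
move=> Dv Du; have [C'2 Cadj] := C_adj.
pose un k := \sum_(j < k | (j : nat) \in J1) dot H u (phi1 j) *: phi1 j.
pose vn k := \sum_(j < k | (j : nat) \in J2) dot H v (phi2 j) *: phi2 j.
have Dun k : D1 (un k).
  by apply: (carrier_sum hD1) => j /set_mem Jj; apply: (carrierZ hD1); exact: b1.1.1.
have Dvn k : D2 (vn k).
  by apply: (carrier_sum hD2) => j /set_mem Jj; apply: (carrierZ hD2); exact: b2.1.1.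
have CC' x y : D2 x -> D1 y -> dot H (C x) y = dot H x (C' y) by exact: Cadj.
have le0 n k : dot H (C (vn n)) (un k) <= ipnorm H v * ipnorm H u.
  pose a := \sum_(j < k | (j : nat) \in J1)
    (dot H u (phi1 j) / Num.sqrt (lam1 j)) *: phi1 j.
  pose b := \sum_(j < n | (j : nat) \in J2)
    (dot H v (phi2 j) / Num.sqrt (lam2 j)) *: phi2 j.
  (* The weight 1 / sqrt(lam1_j lam2_k) in the entries of [C] is shared out between [a] and [b]. *)
  have -> : dot H (C (vn n)) (un k) = dot H (S a) b.
    rewrite CC'// (dot_suml hH) (form_sumr S_semi); apply: eq_bigr => i /set_mem Ji.
    have Di : D2 (phi2 i) by exact: b2.1.1.
    rewrite (dotZl hH) (formZr S_semi) -CC'// (dot_sumr hH) (form_suml S_semi) !mulr_sumr.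
    apply: eq_bigr => j /set_mem Jj.
    rewrite (dotZr hH) (formZl S_semi) C_def// sqrtrM; last exact/ltW/lam1_gt0.
    by field; rewrite !gt_eqF// sqrtr_gt0; [exact: lam2_gt0|exact: lam1_gt0].
  apply: le_trans (ler_norm _) _.
  rewrite -(@ler_pXn2r _ 2)// ?nnegrE ?mulr_ge0 ?ipnorm_ge0//.
  rewrite real_normK ?num_real// exprMn !(ipnorm_sqr hH) mulrC.
  apply: le_trans (form_cauchy_schwarz S_semi a b) _.
  apply: ler_pM; rewrite ?(form_ge0 S_semi)//.
    exact: (root_combination_form D1_closed D1_proj phi1_basis k Du).
  exact: (root_combination_form D2_closed D2_proj phi2_basis n Dv).
(* The limits are taken one after the other: in [k] with [n] fixed, then in [n] after moving [C] to
   its adjoint. *)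
have le1 n : dot H (C (vn n)) u <= ipnorm H v * ipnorm H u.
  have := tends_dot hD1 (C (vn n)) (b1.2 u Du); rewrite [X in _ --> X](dotC hD1) => h.
  apply: (cvg_leP h) => k; rewrite (dotC hD1); exact: le0.
have := tends_dot hD2 (C' u) (b2.2 v Dv); rewrite [X in _ --> X](_ : _ = dot H (C v) u).
  by move=> h; apply: (cvg_leP h) => n; have := le1 n; rewrite CC'.
by rewrite CC'.
Qed.

Variables (p q : nat -> bool) (P Q E1 E2 : V -> V).
Hypotheses (P_diag : diagonal_operator H1 J1 phi1 (fun j => (p j)%:R) P)
  (Q_diag : diagonal_operator H2 J2 phi2 (fun j => (q j)%:R) Q)
  (E1_diag : diagonal_operator H1 J1 phi1
     (fun j => (Num.sqrt (lam1 j) * (p j)%:R)^-1) E1)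
  (E2_diag : diagonal_operator H2 J2 phi2
     (fun j => (Num.sqrt (lam2 j) * (q j)%:R)^-1) E2).

(** In coordinate [j], both sides are limits of sums over the second basis, after S and [C] are
    moved to phi1_j by symmetry and adjunction; the sums agree term by term. *)
Lemma truncated_correlation x : D2 x -> E1 (Y1 (S (Y2 (E2 x)))) = P (C (Q x)).
Proof.
move=> Dx; have [C'2 Cadj] := C_adj.
have DE2 : D2 (E2 x) by exact: E2_diag.1.
have DQ : D2 (Q x) by exact: Q_diag.1.
have DY1 z : D1 (Y1 z) by exact: orthproj_in D1_proj z.
apply: (basis_eq hD1 b1) => [||j Jj].
- exact: E1_diag.1.
- exact/P_diag.1/C_carrier.
have Dj : D1 (phi1 j) by exact: b1.1.1.
rewrite E1_diag.2// P_diag.2//=; last exact: C_carrier.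
have -> : dot H (Y1 (S (Y2 (E2 x)))) (phi1 j) = dot H (S (E2 x)) (phi1 j).
  rewrite (orthproj_dot D1_proj)//.
  by rewrite (orthproj_id D2_closed D2_proj).
have L1 : \sum_(k < n | (k : nat) \in J2)
    (Num.sqrt (lam2 k) * (q k)%:R)^-1 * dot H x (phi2 k) *
      dot H (S (phi1 j)) (phi2 k) @[n --> \oo] --> dot H (S (E2 x)) (phi1 j).
  rewrite (form_sym S_semi) (dotC hH) -(dotC hH (S (phi1 j))).
  have -> : dot H (S (phi1 j)) (E2 x) = dot H (E2 x) (Y2 (S (phi1 j))).
    by rewrite [RHS](dotC hH) (orthproj_dot D2_proj).
  have := parseval hD2 b2 (y := Y2 (S (phi1 j))) DE2.
  apply: cvg_trans; apply: near_eq_cvg; apply: nearW => n /=.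
  apply: eq_bigr => k /set_mem Jk; rewrite -[dot H (E2 x) _]/(dot H2 (E2 x) _).
  rewrite E2_diag.2//= (orthproj_dot D2_proj)//; exact: b2.1.1.
have L2 : \sum_(k < n | (k : nat) \in J2)
    (q k)%:R * dot H x (phi2 k) * (dot H (S (phi1 j)) (phi2 k) /
      Num.sqrt (lam1 j * lam2 k)) @[n --> \oo] --> dot H (C (Q x)) (phi1 j).
  have -> : dot H (C (Q x)) (phi1 j) = dot H2 (Q x) (C' (phi1 j)) by exact: Cadj.
  have := parseval hD2 b2 (y := C' (phi1 j)) DQ.
  apply: cvg_trans; apply: near_eq_cvg; apply: nearW => n /=.
  apply: eq_bigr => k /set_mem Jk; rewrite -[dot H (Q x) _]/(dot H2 (Q x) _).
  rewrite Q_diag.2//= -C_def// (dotC hH (C' _)); congr (_ * _); apply/esym.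
  by apply: Cadj => //; exact: b2.1.1.
set s1 := (fun n : nat => _) in L1; set s2 := (fun n : nat => _) in L2.
have M1 : (fun n => (Num.sqrt (lam1 j) * (p j)%:R)^-1 * s1 n) @ \oo -->
    (Num.sqrt (lam1 j) * (p j)%:R)^-1 * dot H (S (E2 x)) (phi1 j) by exact: cvgMr.
have M2 : (fun n => (p j)%:R * s2 n) @ \oo --> (p j)%:R * dot H (C (Q x)) (phi1 j).
  exact: cvgMr.
apply: (cvg_unique _ M1) => //; apply: cvg_trans M2.
rewrite {M1 L1 L2}/s1 {}/s2; apply: near_eq_cvg; apply: nearW => n /=; rewrite !mulr_sumr.
apply: eq_bigr => k /set_mem Jk; rewrite sqrtrM; last exact/ltW/lam1_gt0.
have l1 : Num.sqrt (lam1 j) != 0 by rewrite gt_eqF// sqrtr_gt0 lam1_gt0.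
have l2 : Num.sqrt (lam2 k) != 0 by rewrite gt_eqF// sqrtr_gt0 lam2_gt0.
(* Where an indicator is 0, the convention 0^-1 = 0 makes both terms vanish. *)
case: (p j); case: (q k); rewrite ?(mulr0, mul0r, invr0, mulr1, mul1r)//.
by field; rewrite l1 l2.
Qed.

End two_blocks.
End covariance_blocks.

(** * Squared canonical correlations as eigenvalues of C C' and of its compressions *)

Theorem theorem7p1 (R : realType)
    (* H = L^2(E, nu) *)
    (E : set R) (t0 : E)
    (nu : {measure set (traceBorel t0) -> \bar R})
    (nu_sfinite : sigma_finite setT nu)
    (H := L2space nu)
    (* the random element X of H *)
    (dO : measure_display) (Omega : measurableType dO) (P : probability Omega R)
    (X : Omega -> L2 nu)
    (X_random : random_element H X)
    (X_centered : has_mean P H X 0)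
    (X_moment : (\int[P]_w (ipnorm H (X w) ^+ 4)%:E < +oo)%E)
    (S : L2 nu -> L2 nu) (S_cov : is_covariance P H X S)
    (* H = D1 (+) D2 *)
    (D1 D2 : set (L2 nu))
    (D1_closed : closed_subspace H D1) (D2_closed : closed_subspace H D2)
    (D12_orth : forall x y, D1 x -> D2 y -> dot H x y = 0)
    (D12_sum : forall x : L2 nu, exists x1 x2, [/\ D1 x1, D2 x2 & x = x1 + x2])
    (H1 := ip_restrict H D1) (H2 := ip_restrict H D2)
    (Y1 := orthproj H D1) (Y2 := orthproj H D2)
    (X1 := fun w => Y1 (X w)) (X2 := fun w => Y2 (X w))
    (S1 := fun x => Y1 (S (Y1 x))) (S2 := fun x => Y2 (S (Y2 x)))
    (S12 := fun x => Y1 (S (Y2 x)))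
    (S1_inj : {in D1 &, injective S1}) (S2_inj : {in D2 &, injective S2})
    (* eigenbases of S1 and S2 *)
    (J1 J2 : set nat) (phi1 phi2 : nat -> L2 nu) (lam1 lam2 : nat -> R)
    (phi1_basis : eigenbasis H1 S1 J1 phi1 lam1)
    (phi2_basis : eigenbasis H2 S2 J2 phi2 lam2)
    (gamma := fun j k : nat =>
       fine ('E_P[fun w => (dot H (X1 w) (phi1 j) * dot H (X2 w) (phi2 k))%R])%E)
    (* the reproducing kernel Hilbert spaces H(K_1) and H(K_2) *)
    (HK1 := rkhs H1 S1 J1 phi1 lam1) (HK2 := rkhs H2 S2 J2 phi2 lam2)
    (Gamma1 Gamma2 : L2 nu -> L2 nu)
    (Gamma1_def : is_Gamma H1 J1 phi1 lam1 Gamma1)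
    (Gamma2_def : is_Gamma H2 J2 phi2 lam2 Gamma2)
    (Gamma2_inv := 'pinv_(fun=> 0) D2 Gamma2)
    (* T = Gamma1 C Gamma2^-1 *)
    (C : L2 nu -> L2 nu) (C_bounded : bounded_operator H2 H1 C)
    (C_def : forall j k, J1 j -> J2 k ->
       dot H (C (phi2 k)) (phi1 j) = gamma j k / Num.sqrt (lam1 j * lam2 k))
    (T := fun g => Gamma1 (C (Gamma2_inv g)))
    (T_svd : has_svd HK2 HK1 T)
    (Tadj : L2 nu -> L2 nu) (Tadj_def : is_adjoint HK2 HK1 T Tadj)
    (* T(m) *)
    (root_dag1 := fun m => mp_inverse H1 H1 (op_sqrt H1 (truncation H1 S1 m)))
    (root_dag2 := fun m => mp_inverse H2 H2 (op_sqrt H2 (truncation H2 S2 m)))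
    (Tm := fun m g => Gamma1 (root_dag1 m (S12 (root_dag2 m (Gamma2_inv g)))))
    (Tmadj : nat -> L2 nu -> L2 nu)
    (Tmadj_def : forall m, (1 <= m)%N -> is_adjoint HK2 HK1 (Tm m) (Tmadj m))
    (* squared canonical correlations, indexed from 0 *)
    (rho2 := eigenvalues HK1 (T \o Tadj))
    (rho2m := fun m => eigenvalues HK1 (Tm m \o Tmadj m)) :
  forall j : nat,
    [/\ forall m, (1 <= m)%N -> 0 <= rho2m m j,
        forall m n, (1 <= m)%N -> (m <= n)%N -> rho2m m j <= rho2m n j,
        rho2m m j @[m --> \oo] --> rho2 j &
        rho2 j <= 1].
Proof.
have hH : inner_product H := L2_inner_product nu.
have cT : carrier H = setT by [].
have S_semi : semidefinite (fun h g => dot H (S h) g).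
  exact: (covariance_semidefinite hH cT S_cov).
(* The components of the orthogonal decomposition are themselves the projections. *)
have D1_proj (x : L2 nu) : exists2 p, D1 p & forall q, D1 q -> dot H (x - p) q = 0.
  have [x1 [x2 [Dx1 Dx2 ->]]] := D12_sum x; exists x1 => // q Dq.
  by rewrite addrAC subrr add0r (dotC hH) D12_orth.
have D2_proj (x : L2 nu) : exists2 p, D2 p & forall q, D2 q -> dot H (x - p) q = 0.
  have [x1 [x2 [Dx1 Dx2 ->]]] := D12_sum x; exists x2 => // q Dq.
  by rewrite addrK D12_orth.
have hH1 : inner_product H1 by exact: ip_restrict_inner_product.
have hH2 : inner_product H2 by exact: ip_restrict_inner_product.
have b1 : orthonormal_basis H1 J1 phi1 by case: phi1_basis.
have b2 : orthonormal_basis H2 J2 phi2 by case: phi2_basis.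
have S1_diag := block_diagonal hH S_semi D1_closed D1_proj phi1_basis.
have S2_diag := block_diagonal hH S_semi D2_closed D2_proj phi2_basis.
have G1_diag := Gamma_diagonal hH cT D1_closed phi1_basis Gamma1_def.
have G2_diag := Gamma_diagonal hH cT D2_closed phi2_basis Gamma2_def.
have fin1 c : 0 < c -> exists N, forall j, J1 j -> c <= lam1 j -> (j < N)%N.
  have [tr htr] := covariance_trace_bounded hH cT X_random S_cov X_moment
    (conj (fun _ _ => Logic.I) b1.1.2 : orthonormal_family H J1 phi1).
  have [dn _ _ dec _] := phi1_basis; apply: (trace_bounded_finite (tr := tr) dn dec) => n.
  apply: le_trans (htr n); rewrite le_eqVlt; apply/orP; left; apply/eqP.
  apply: eq_bigr => j /set_mem Jj.
  by rewrite (covariance_basis hH D1_closed D1_proj phi1_basis)// eqxx mulr1.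
have fin2 c : 0 < c -> exists N, forall j, J2 j -> c <= lam2 j -> (j < N)%N.
  have [tr htr] := covariance_trace_bounded hH cT X_random S_cov X_moment
    (conj (fun _ _ => Logic.I) b2.1.2 : orthonormal_family H J2 phi2).
  have [dn _ _ dec _] := phi2_basis; apply: (trace_bounded_finite (tr := tr) dn dec) => n.
  apply: le_trans (htr n); rewrite le_eqVlt; apply/orP; left; apply/eqP.
  apply: eq_bigr => j /set_mem Jj.
  by rewrite (covariance_basis hH D2_closed D2_proj phi2_basis)// eqxx mulr1.
(* Injectivity makes both partial inverses genuine on the images of [Gamma1] and [Gamma2]; the
   default 0 is used only elsewhere. *)
pose W1 := 'pinv_(fun=> 0) D1 Gamma1.
have WG1 x : D1 x -> W1 (Gamma1 x) = x.
  by move=> Dx; apply: (pinvKV (fun=> 0) (Gamma_inj hH1 phi1_basis G1_diag)); exact/mem_set.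
have WG2 x : D2 x -> Gamma2_inv (Gamma2 x) = x.
  by move=> Dx; apply: (pinvKV (fun=> 0) (Gamma_inj hH2 phi2_basis G2_diag)); exact/mem_set.
have iG1 : isometry H1 HK1 Gamma1 := Gamma_isometry hH1 phi1_basis S1_diag G1_diag.
have iG2 : isometry H2 HK2 Gamma2 := Gamma_isometry hH2 phi2_basis S2_diag G2_diag.
have iW1 : isometry HK1 H1 W1 := Gamma_inv_isometry hH1 phi1_basis S1_diag G1_diag WG1.
have iW2 : isometry HK2 H2 Gamma2_inv :=
  Gamma_inv_isometry hH2 phi2_basis S2_diag G2_diag WG2.
have GW1 : forall y, carrier HK1 y -> Gamma1 (W1 y) = y :=
  Gamma_W hH1 phi1_basis S1_diag G1_diag WG1.
have GW2 : forall y, carrier HK2 y -> Gamma2 (Gamma2_inv y) = y :=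
  Gamma_W hH2 phi2_basis S2_diag G2_diag WG2.
have [C_carrier C_lin _] := C_bounded.
pose C' := fun x => Gamma2_inv (Tadj (Gamma1 x)).
(* Conjugation by the unitaries carries adjoints between the kernel spaces to adjoints between the
   blocks. *)
have pull U U' : (forall y, D2 y -> D1 (U y)) ->
    is_adjoint HK2 HK1 (fun g => Gamma1 (U (Gamma2_inv g))) U' ->
    is_adjoint H2 H1 U (fun x => Gamma2_inv (U' (Gamma1 x))).
  move=> U_carrier [U'c U'adj]; split=> [x Dx|y x Dy Dx].
    exact/(isometry_carrier iW2)/U'c/(isometry_carrier iG1).
  have Kx := isometry_carrier iG1 Dx; have Ky := isometry_carrier iG2 Dy.
  rewrite -(isometry_dot iG1 (U_carrier y Dy) Dx).
  have := U'adj (Gamma2 y) (Gamma1 x) Ky Kx; rewrite WG2// => ->.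
  by rewrite -(isometry_dot iW2 Ky (U'c _ Kx)) WG2.
have C_adj : is_adjoint H2 H1 C C' by exact: pull.
have C'_carrier x : D1 x -> D2 (C' x) by exact: C_adj.1.
have C_svd : exists rho g f, is_svd H2 H1 C rho g f.
  have [rho [g [f hsvd]]] := T_svd.
  exists rho, (Gamma2_inv \o g), (W1 \o f); apply: (isometry_svd iW2 iW1 _ _ _ hsvd).
  - move=> y Dy; exists (Gamma2 y); first exact: (isometry_carrier iG2).
    by rewrite WG2.
  - move=> x Kx; exact/(isometry_carrier iG1)/C_carrier/(isometry_carrier iW2).
  - by move=> x Kx; rewrite WG1//; exact/C_carrier/(isometry_carrier iW2).
have [rho [g [f {}C_svd]]] := C_svd.
(* Projecting [X] does not change its products with vectors of the block, so gamma_jk = <S phi1_j,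
   phi2_k>. *)
have C_coef j k : J1 j -> J2 k -> dot H (C (phi2 k)) (phi1 j) =
    dot H (S (phi1 j)) (phi2 k) / Num.sqrt (lam1 j * lam2 k).
  move=> Jj Jk; rewrite C_def//; congr (_ / _).
  rewrite -[RHS]/(fine (dot H (S (phi1 j)) (phi2 k))%:E).
  rewrite -(covarianceE hH cT S_cov); congr fine; congr expectation.
  apply/funext => w; rewrite /X1 /X2 /Y1 /Y2.
  by rewrite (orthproj_dot hH D1_proj) ?(orthproj_dot hH D2_proj)//;
    [exact: b2.1.1|exact: b1.1.1].
have C_contr y x : D2 y -> D1 x -> dot H1 (C y) x <= ipnorm H2 y * ipnorm H1 x.
  move=> Dy Dx; exact: (covariance_contraction hH S_semi D1_closed D2_closed
    D1_proj D2_proj phi1_basis phi2_basis C_adj C_coef Dy Dx).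
pose p := leading H1 S1 lam1; pose q := leading H2 S2 lam2.
pose Pi := leading_projection H1 S1; pose Qi := leading_projection H2 S2.
have Pi_diag m : diagonal_operator H1 J1 phi1 (fun j => (p m j)%:R) (Pi m).
  exact: (leading_projection_diagonal hH1 phi1_basis S1_diag fin1).
have Qi_diag m : diagonal_operator H2 J2 phi2 (fun j => (q m j)%:R) (Qi m).
  exact: (leading_projection_diagonal hH2 phi2_basis S2_diag fin2).
pose K m := (fun y => Pi m (C (Qi m y))) \o (fun x => Qi m (C' (Pi m x))).
have rho2E : rho2 = eigenvalues H1 (C \o C').
  apply: (isometry_eigenvalues iG1 iW1 WG1 GW1) => // x Dx.
  exact/C_carrier/C'_carrier.
have PC y m : D2 y -> Pi m (C (Qi m y)) = root_dag1 m (S12 (root_dag2 m y)).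
  move=> Dy; apply/esym.
  apply: (truncated_correlation hH S_semi D1_closed D2_closed D1_proj D2_proj
    phi1_basis phi2_basis C_adj C_coef C_carrier (Pi_diag m) (Qi_diag m)) => //.
  - exact: (truncation_root_mp_inverse hH1 phi1_basis S1_diag fin1).
  - exact: (truncation_root_mp_inverse hH2 phi2_basis S2_diag fin2).
have rho2mE m : (1 <= m)%N -> rho2m m = eigenvalues H1 (K m).
  move=> m1; have Bc y : D2 y -> D1 (Pi m (C (Qi m y))).
    by move=> Dy; exact/(Pi_diag m).1/C_carrier/(Qi_diag m).1.
  have Badj := compression_adjoint hH1 hH2 b1 b2 Pi_diag Qi_diag C_carrier C_adj m.
  have Tadj' : is_adjoint H2 H1 (fun y => root_dag1 m (S12 (root_dag2 m y)))
      (fun x => Gamma2_inv (Tmadj m (Gamma1 x))).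
    by apply: pull; [move=> y Dy; rewrite -PC//; exact: Bc | exact: Tmadj_def].
  (* Two adjoints of one operator agree on the carrier, which identifies the given [Tmadj m]. *)
  have adjE x : D1 x -> Gamma2_inv (Tmadj m (Gamma1 x)) = Qi m (C' (Pi m x)).
    move=> Dx; apply: (ip_eq hH2) => [||z Dz]; [exact: Tadj'.1|exact: Badj.1|].
    by rewrite !(dotC hH2 _ z) -Tadj'.2// -Badj.2// PC.
  apply: (isometry_eigenvalues iG1 iW1 WG1 GW1) => x Dx; last first.
    exact/Bc/Badj.1.
  by rewrite /= /Tm adjE// -PC//; exact: Badj.1.
move=> j; have [dn _ _ _ _] := phi1_basis.
have [ge0 mono cvg le1] := compression_eigenvalues hH1 hH2 b1 b2 dn Pi_diag Qi_diag
  (@leadingS _ _ _ _ _) (@leadingS _ _ _ _ _)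
  (leading_eventually hH1 phi1_basis S1_diag) (leading_eventually hH2 phi2_basis S2_diag)
  (leading_support phi1_basis fin1) C_carrier C_lin C_adj C_svd C_contr j.
split=> [m m1|m n m1 mn||].
- by rewrite rho2mE//; exact: ge0.
- by rewrite !rho2mE ?(leq_trans m1)//; exact: mono.
(* [Tmadj] is specified from m = 1 on, so the sequences are identified only from there. *)
- rewrite rho2E; apply: cvg_trans cvg; apply: near_eq_cvg; exists 1%N => // m /= m1.
  by rewrite rho2mE.
- by rewrite rho2E.
Qed.
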